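(* Let $(M,\Omega)$ be a compact connected oriented manifold with volume form $\Omega$. Then $$\overline{\mathrm{Diff}^{\infty}(M,\Omega)}^{C^0} \cap \mathrm{Diff}^{\infty}(M) = \mathrm{Diff}^{\infty}(M,\Omega).$$
   Context: $\mathrm{Diff}^{\infty}(M)$ is the group of smooth diffeomorphisms of $M$, and $\mathrm{Diff}^{\infty}(M,\Omega) = \{\phi\in\mathrm{Diff}^{\infty}(M): \phi^*\Omega=\Omega\}$ is the group of volume-preserving diffeomorphisms. $\overline{\,\cdot\,}^{C^0}$ denotes closure for uniform ($C^0$) convergence: $\psi\in\mathrm{Diff}^{\infty}(M)$ lies in the $C^0$-closure of a set $G$ of diffeomorphisms iff there is a sequence $\psi_i\in G$ with $\sup_{x\in M} d(\psi_i(x),\psi(x))\to 0$, where $d$ is the distance induced by a Riemannian metric on $M$. *)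

(* Defs.v *)
From HB Require Import structures.
From mathcomp Require Import all_boot all_order all_algebra.
From mathcomp Require Import all_classical all_reals all_analysis.

Set Implicit Arguments.
Unset Strict Implicit.
Unset Printing Implicit Defensive.

Import Order.TTheory GRing.Theory Num.Theory.
Import numFieldNormedType.Exports.

Local Open Scope classical_set_scope.
Local Open Scope ring_scope.

(* Only meant for U open and V finite-dimensional; a differentiable map is
   C^(k+1) iff all its directional derivatives are C^k. *)
Fixpoint Ck {R : realType} {V W : normedModType R} (k : nat)
    (U : set V) (f : V -> W) : Prop :=
  match k with
  | 0 => forall x, U x -> {for x, continuous f}
  | k'.+1 => (forall x, U x -> differentiable f x) /\
             (forall v : V, Ck k' U ('D_v f))
  end.

Definition Cinfty {R : realType} {V W : normedModType R}
    (U : set V) (f : V -> W) : Prop := forall k, Ck k U f.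

(* A homeomorphism from an open subset of T onto an open subset of R^n; the
   values of chart_map and chart_inv outside these sets are irrelevant. *)
Record chart (R : realType) (n : nat) (T : topologicalType) := Chart {
  chart_dom : set T ;
  chart_map :> T -> 'rV[R]_n ;
  chart_inv : 'rV[R]_n -> T ;
  chart_dom_open : open chart_dom ;
  chart_img_open : open (chart_map @` chart_dom) ;
  chart_mapK : forall p, chart_dom p -> chart_inv (chart_map p) = p ;
  chart_map_continuous :
    forall p, chart_dom p -> {for p, continuous chart_map} ;
  chart_inv_continuous :
    forall x, (chart_map @` chart_dom) x -> {for x, continuous chart_inv} }.

Definition chart_img (R : realType) (n : nat) (T : topologicalType)
    (c : chart R n T) : set 'rV[R]_n := c @` chart_dom c.

(* Without boundary: the charts are onto open subsets of R^n. The atlas is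
   indexed by chart_idx and need not be maximal; chart_at picks a chart of it
   around each point. *)
Record smooth_manifold (R : realType) (n : nat) := SmoothManifold {
  carrier :> topologicalType ;
  manifold_hausdorff : hausdorff_space carrier ;
  manifold_second_countable : @second_countable carrier ;
  chart_idx : Type ;
  atlas : chart_idx -> chart R n carrier ;
  chart_at : carrier -> chart_idx ;
  chart_at_dom : forall p, chart_dom (atlas (chart_at p)) p ;
  atlas_smooth : forall i j,
    Cinfty (atlas i @` (chart_dom (atlas i) `&` chart_dom (atlas j)))
           (atlas j \o chart_inv (atlas i)) }.

Section Manifold.
Context {R : realType} {n : nat} {M : smooth_manifold R n}.
Implicit Types (p : M) (i j : chart_idx M) (phi : M -> M).

Definition in_chart i p : Prop := chart_dom (atlas i) p.

Definition local_rep i j phi : 'rV[R]_n -> 'rV[R]_n :=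
  atlas j \o phi \o chart_inv (atlas i).

(* The matrix of d(phi)_p in the coordinates i at p and j at phi p. Tangent
   vectors are row vectors: v has image v *m jac i j phi p. *)
Definition jac i j phi p : 'M[R]_n := 'J (local_rep i j phi) (atlas i p).

Definition smooth_map phi : Prop :=
  continuous phi /\
  forall i j, Cinfty (atlas i @` (chart_dom (atlas i) `&`
                                  phi @^-1` chart_dom (atlas j)))
                     (local_rep i j phi).

(* The Jacobians are those of the coordinate changes, which are the local
   representatives of the identity. *)
Definition oriented_atlas : Prop :=
  forall i j p, in_chart i p -> in_chart j p -> 0 < \det (jac i j id p).

(* Alternating n-linear forms on R^n, as functions of the n x n matrix whose
   rows are the n arguments. *)
Definition alternating_form (f : 'M[R]_n -> R) : Prop :=
  (forall k A B C b c,
     row k A = b *: row k B + c *: row k C ->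
     row' k B = row' k A -> row' k C = row' k A ->
     f A = b * f B + c * f C) /\
  (forall A k l, k != l -> row k A = row l A -> f A = 0).

End Manifold.

Arguments oriented_atlas {R n} M.

(* form_val omega i p A is the value of omega_p on the n tangent vectors at p
   whose coordinates in the chart i are the rows of A. *)
Record top_form (R : realType) (n : nat) (M : smooth_manifold R n) := TopForm {
  form_val :> chart_idx M -> M -> 'M[R]_n -> R ;
  form_alternating :
    forall i p, in_chart i p -> alternating_form (form_val i p) ;
  form_compat : forall i j p A, in_chart i p -> in_chart j p ->
    form_val i p A = form_val j p (A *m jac i j id p) ;
  form_smooth : forall i A,
    Cinfty (chart_img (atlas i))
           (fun x => form_val i (chart_inv (atlas i) x) A : R^o) }.

Definition volume_form (R : realType) (n : nat) (M : smooth_manifold R n)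
    (Omega : top_form M) : Prop :=
  forall i p, in_chart i p -> exists A, Omega i p A != 0.

(* (phi^* Omega)_p(v_1, .., v_n) = Omega_(phi p)(dphi v_1, .., dphi v_n); the
   chart used at phi p does not matter, by form_compat. *)
Definition pullback (R : realType) (n : nat) (M : smooth_manifold R n)
    (phi : M -> M) (Omega : top_form M) (i : chart_idx M) (p : M)
    (A : 'M[R]_n) : R :=
  let j := chart_at (phi p) in Omega j (phi p) (A *m jac i j phi p).

Definition Diff (R : realType) (n : nat) (M : smooth_manifold R n) :
    set (M -> M) :=
  [set phi | smooth_map phi /\
     exists psi : M -> M,
       [/\ smooth_map psi, cancel phi psi & cancel psi phi] ].

Arguments Diff {R n} M _.

Definition Diff_vol (R : realType) (n : nat) (M : smooth_manifold R n)
    (Omega : top_form M) : set (M -> M) :=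
  [set phi | Diff M phi /\
     forall i p A, in_chart i p -> pullback phi Omega i p A = Omega i p A].

(* metric_val g i p is the Gram matrix (g_kl) of g_p in the coordinates i. *)
Record riemannian_metric (R : realType) (n : nat) (M : smooth_manifold R n) :=
    RiemannianMetric {
  metric_val :> chart_idx M -> M -> 'M[R]_n ;
  metric_sym : forall i p, in_chart i p -> (metric_val i p)^T = metric_val i p ;
  metric_pos : forall i p (v : 'rV[R]_n), in_chart i p -> v != 0 ->
    0 < (v *m metric_val i p *m v^T) 0 0 ;
  metric_compat : forall i j p, in_chart i p -> in_chart j p ->
    metric_val i p = jac i j id p *m metric_val j p *m (jac i j id p)^T ;
  metric_smooth : forall i,
    Cinfty (chart_img (atlas i))
           (fun x => metric_val i (chart_inv (atlas i) x)) }.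

Section RiemannianDistance.
Context {R : realType} {n : nat} {M : smooth_manifold R n}.
Variable g : riemannian_metric M.
Implicit Types sigma : R -> M.

Definition smooth_curve sigma : Prop :=
  continuous sigma /\
  forall i : chart_idx M,
    Cinfty (sigma @^-1` chart_dom (atlas i) : set R^o) (atlas i \o sigma).

Definition speed sigma (t : R) : R :=
  let i := chart_at (sigma t) in
  let v : 'rV[R]_n := derive1 (atlas i \o sigma) t in
  Num.sqrt ((v *m g i (sigma t) *m v^T) 0 0).

Definition curve_length sigma : R :=
  \int[lebesgue_measure]_(t in `[0, 1]) speed sigma t.

(* pw_path p q l: a piecewise smooth path of length l goes from p to q. Each
   piece is parametrized by [0, 1] and is the restriction of a smooth curve
   R -> M, i.e. it is smooth up to its end points. *)
Inductive pw_path (p : M) : M -> R -> Prop :=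
  | pw_path_nil : pw_path p p 0
  | pw_path_rcons (l : R) (sigma : R -> M) :
      pw_path p (sigma 0) l -> smooth_curve sigma ->
      pw_path p (sigma 1) (l + curve_length sigma).

Definition riem_dist (p q : M) : \bar R :=
  ereal_inf [set l%:E | l in [set l : R | pw_path p q l]].

Definition C0_closure (G : set (M -> M)) : set (M -> M) :=
  [set psi | exists2 psi_ : nat -> M -> M, (forall k, G (psi_ k)) &
     ereal_sup [set riem_dist (psi_ k x) (psi x) | x in [set: M]]
       @[k --> \oo] --> 0%E].

End RiemannianDistance.

(* Main.v *)
Require Import Defs.
From mathcomp Require Import all_boot all_order all_algebra all_fingroup.
From mathcomp Require Import all_classical all_reals all_analysis.
From mathcomp Require Import ring lra.

Set Implicit Arguments.
Unset Strict Implicit.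
Unset Printing Implicit Defensive.

Import Order.TTheory GRing.Theory Num.Theory.
Import numFieldNormedType.Exports.

Local Open Scope classical_set_scope.
Local Open Scope ring_scope.

(** In charts, a diffeomorphism [phi] preserves a volume form with densities
    [rho], [rho'] exactly when [rho' (phi x) * det (D phi x) = rho x]
    ([Diff_volP]); the sign of the determinant makes it an equation between
    forms and not only between measures. Let [psi] be a C^0 limit of such maps. A bump function
    of the coordinates is Lipschitz for the Riemannian distance, so that
    closeness in this distance gives closeness of coordinates, locally
    uniformly ([chart_control]). What remains is a statement in R^n
    ([jacobian_limit]): [F] is the local representative of [psi] near [x0],
    and there are maps [G] with [rho' (G x) * det (D G x) = rho x], uniformly
    as close to [F] as desired on a fixed neighbourhood of [x0]; then [F]
    satisfies the same equation at [x0].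

    The determinants of [D G] may oscillate wildly, but they are controlled
    after weighting with a function [f] of [G x]: if [f] vanishes on the points
    [(1 - t) F x + t G x] with [x] on the boundary of a cube, then the
    integrals over the cube of [f (F x) det (D F x)] and of
    [f (G x) det (D G x)] agree. This is the homotopy invariance behind the
    degree of a map. With [h (t, x) = (1 - t) F x + t G x], the Jacobian
    determinant of [u = (f o h, h)] vanishes because its first component is a
    function of the others, while a Jacobian determinant is always a divergence
    ([div_minor_field]); the time component of the field is
    [f (h) det (D_x h)], and its other components vanish on the boundary.

    Take [f = beta rho'], with [beta] a bump function supported near [F x0].
    The integral of [beta (F x) (rho x - rho' (F x) det (D F x))] is then that
    of [(beta (F x) - beta (G x)) rho x], which is arbitrarily small. If the
    second factor were not zero at [x0], it would have a constant sign on a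
    small cube; as [psi] has a continuous inverse, [x] is close to [x0] when
    [F x] is close to [F x0] ([inverse_rep_control]), so that the support of
    [beta o F] can be kept inside the cube, and the integral would be bounded
    away from zero. Hence the equation holds at [x0].

    Sums over fine grids play the part of the integrals. The fact that a
    derivative of a function vanishing on the boundary has integral zero
    becomes the invariance of a grid sum under a cyclic shift of the grid
    ([grid_sum_shift]), up to an error that is small by uniform
    differentiability ([uniform_difference]); the time derivative commutes with
    finite sums. *)

(** * Calculus of C^k maps *)

Section LocalEquality.
Context {R : realType} {V W : normedModType R}.
Implicit Types (U : set V) (f g : V -> W).

Lemma open_near_eq U f g x : open U -> U x -> (forall y, U y -> f y = g y) ->
  \near x, f x = g x.
Proof.
by move=> oU Ux fg; near=> y; apply: fg; near: y; exact: open_nbhs_nbhs.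
Unshelve. all: by end_near. Qed.

Lemma near_eq_littleo f g x (df : {linear V -> W}) : (\near x, f x = g x) ->
  f \o shift x = cst (f x) + df +o_ 0 id ->
  g \o shift x = cst (g x) + df +o_ 0 id.
Proof.
move=> fg /eqaddoP fo; have fgx : f x = g x by exact: nbhs_singleton fg.
apply/eqaddoP => e e0; have := fo e e0; rewrite -fgx.
apply: filter_app.
have : \forall y \near 0, f (y + x) = g (y + x).
  by move: fg; rewrite (near_shift 0 x (fun y => f y = g y)) subr0.
apply: filterS => y fgy.
by rewrite ![(_ - _ : _ -> _) _]/(_ - _) /= fgy.
Qed.

Lemma near_eq_diff f g x : (\near x, f x = g x) -> differentiable f x ->
  differentiable g x /\ 'd g x = 'd f x :> (V -> W).
Proof.
move=> fg df; have [cf fo] := (diff_locallyP x f).1 df.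
have go := near_eq_littleo fg fo.
have E : 'd g x = 'd f x :> (V -> W) by exact: diff_unique.
by split; [apply/diff_locallyP; rewrite E|exact: E].
Qed.

Lemma open_preimage U (B : set W) f : open U -> open B ->
  (forall x, U x -> {for x, continuous f}) -> open (U `&` f @^-1` B).
Proof.
move=> oU oB ch; rewrite openE => x [Ux Bx]; apply: filterI.
  exact: open_nbhs_nbhs.
by apply: ch => //; exact: open_nbhs_nbhs.
Qed.

End LocalEquality.

Section CkBasics.
Context {R : realType}.
Implicit Types (V W : normedModType R) (k : nat).

Lemma Ck_eq V W k (U : set V) (f g : V -> W) : open U ->
  (forall x, U x -> f x = g x) -> Ck k U f -> Ck k U g.
Proof.
move=> oU; elim: k f g => [|k IH] f g fg /=.
  move=> cf x Ux; have nfg := open_near_eq oU Ux fg.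
  rewrite /prop_for /continuous_at -(nbhs_singleton nfg).
  by apply: cvg_trans (cf x Ux); apply: near_eq_cvg; apply: filterS nfg.
move=> [df Df]; split.
  move=> x Ux; have nfg := open_near_eq oU Ux fg.
  by have [] := near_eq_diff nfg (df x Ux).
move=> v; apply: IH (Df v) => x Ux.
by apply: near_eq_derive; apply: open_near_eq oU Ux fg.
Qed.

Lemma Ck_sub V W k (U U' : set V) (f : V -> W) : U' `<=` U ->
  Ck k U f -> Ck k U' f.
Proof.
move=> UU'; elim: k f => [|k IH] f /=; first by move=> cf x /UU'/cf.
by move=> [df Df]; split => [x /UU'/df|v]//; exact: IH.
Qed.

Lemma Ck_continuous V W k (U : set V) (f : V -> W) : Ck k U f -> Ck 0 U f.
Proof.
case: k => // k [df _] x Ux; exact/differentiable_continuous/df.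
Qed.

Lemma CkW V W k (U : set V) (f : V -> W) : Ck k.+1 U f -> Ck k U f.
Proof.
elim: k f => [|k IH] f; first exact: Ck_continuous.
by move=> [df Df]; split => // v; exact/IH/Df.
Qed.

Lemma Ck_cst V W k (U : set V) (c : W) : Ck k U (fun=> c).
Proof.
elim: k c => [|k IH] c /=; first by move=> x _; exact: cst_continuous.
split => [x _|v]; first exact: differentiable_cst.
have -> : 'D_v (fun=> c) = (fun=> 0) :> (V -> W); last exact: IH.
by apply/funext => x; rewrite derive_cst.
Qed.

Lemma CkD V W k (U : set V) (f g : V -> W) : open U ->
  Ck k U f -> Ck k U g -> Ck k U (fun x => f x + g x).
Proof.
move=> oU; elim: k f g => [|k IH] f g /=.
  by move=> cf cg x Ux; apply: cvgD; [exact: cf|exact: cg].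
move=> [df Df] [dg Dg]; split.
  by move=> x Ux; apply: differentiableD; [exact: df|exact: dg].
move=> v; apply: (Ck_eq oU _ (IH _ _ (Df v) (Dg v))) => x Ux.
by rewrite -deriveD//; apply: diff_derivable; [exact: df|exact: dg].
Qed.

Lemma CkM V k (U : set V) (f g : V -> R) : open U ->
  Ck k U f -> Ck k U g -> Ck k U (fun x => f x * g x).
Proof.
move=> oU; elim: k f g => [|k IH] f g.
  by move=> cf cg x Ux; apply: cvgM; [exact: cf|exact: cg].
move=> Cf Cg; have [df Df] := Cf; have [dg Dg] := Cg; split.
  by move=> x Ux; apply: differentiableM; [exact: df|exact: dg].
move=> v; have := CkD oU (IH _ _ (CkW Cf) (Dg v)) (IH _ _ (CkW Cg) (Df v)).
apply: (Ck_eq oU) => x Ux.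
by rewrite -[LHS]deriveM//; apply: diff_derivable; [exact: df|exact: dg].
Qed.

Lemma Ck_sum V W k (U : set V) (I : Type) (r : seq I) (P : pred I)
  (f : I -> V -> W) : open U -> (forall i, P i -> Ck k U (f i)) ->
  Ck k U (fun x => \sum_(i <- r | P i) f i x).
Proof.
move=> oU Cf; elim: r => [|i r IH].
  by apply: Ck_eq oU _ (Ck_cst k U (0 : W)) => x _; rewrite big_nil.
case: (boolP (P i)) => Pi; last first.
  by apply: Ck_eq oU _ IH => x _; rewrite big_cons (negbTE Pi).
by apply: Ck_eq oU _ (CkD oU (Cf i Pi) IH) => x _; rewrite big_cons Pi.
Qed.

Lemma Ck_prod V k (U : set V) (I : Type) (r : seq I) (P : pred I)
  (f : I -> V -> R) : open U -> (forall i, P i -> Ck k U (f i)) ->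
  Ck k U (fun x => \prod_(i <- r | P i) f i x).
Proof.
move=> oU Cf; elim: r => [|i r IH].
  by apply: Ck_eq oU _ (Ck_cst k U (1 : R)) => x _; rewrite big_nil.
case: (boolP (P i)) => Pi; last first.
  by apply: Ck_eq oU _ IH => x _; rewrite big_cons (negbTE Pi).
by apply: Ck_eq oU _ (CkM oU (Cf i Pi) IH) => x _; rewrite big_cons Pi.
Qed.

Lemma CkN V k (U : set V) (f : V -> R) : open U ->
  Ck k U f -> Ck k U (fun x => - f x).
Proof.
move=> oU Cf; apply: (Ck_eq oU _ (CkM oU (@Ck_cst V R k U (-1)) Cf)) => x _.
by rewrite mulN1r.
Qed.

Lemma CkB V k (U : set V) (f g : V -> R) : open U ->
  Ck k U f -> Ck k U g -> Ck k U (fun x => f x - g x).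
Proof. by move=> oU Cf Cg; apply: CkD => //; exact: CkN. Qed.

Lemma linear_derive V W (L : {linear V -> W}) x v :
  continuous L -> 'D_v L x = L v.
Proof.
move=> cL; have dL : differentiable L x by exact: linear_differentiable.
by rewrite deriveE// diff_lin.
Qed.

Lemma Ck_lin V W k (U : set V) (L : {linear V -> W}) : continuous L ->
  Ck k U L.
Proof.
move=> cL; case: k => [x _|k]; first exact: cL.
split=> [x _|v]; first exact: linear_differentiable.
have -> : 'D_v L = (fun=> L v) by apply/funext => x; exact: linear_derive.
exact: Ck_cst.
Qed.

Lemma derive_comp_lin V V' W (L : {linear V' -> V}) (f : V -> W) x v :
  'D_v (f \o L) x = 'D_(L v) f (L x).
Proof.
rewrite /derive; set d := (fun _ : R => _); set d' := (fun _ : R => _).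
suff -> : d = d' by [].
by apply/funext => h; rewrite /d /d' /= linearP.
Qed.

Lemma Ck_comp_lin V V' W k (U : set V) (L : {linear V' -> V}) (f : V -> W) :
  continuous L -> Ck k U f -> Ck k (L @^-1` U) (f \o L).
Proof.
move=> cL; elim: k f => [|k IH] f /=.
  by move=> cf x Ux; apply: continuous_comp; [exact: cL|exact: cf].
move=> [df Df]; split => [x Ux|v].
  by apply: differentiable_comp; [exact: linear_differentiable|exact: df].
have -> : 'D_v (f \o L) = 'D_(L v) f \o L.
  by apply/funext => x; rewrite derive_comp_lin.
exact: IH.
Qed.

Lemma derive_entry V m n (M : V -> 'M[R]_(m, n)) x v a b :
  differentiable M x -> 'D_v (fun y => M y a b) x = ('D_v M x) a b.
Proof.
by move=> dM; rewrite derive_mx ?mxE//; exact: diff_derivable.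
Qed.

Lemma Ck_entry V m n k (U : set V) (M : V -> 'M[R]_(m, n)) a b : open U ->
  Ck k U M -> Ck k U (fun x => M x a b).
Proof.
move=> oU; elim: k M => [|k IH] M /=.
  move=> cM x Ux; apply: (@continuous_comp _ _ _ M (fun N => N a b)).
    exact: cM.
  exact: coord_continuous.
move=> [dM DM]; split => [x Ux|v].
  apply: (@differentiable_comp _ _ _ _ M (fun N : 'M[R]_(m, n) => N a b)).
    exact: dM.
  exact: differentiable_coord.
apply: (Ck_eq oU _ (IH _ (DM v))) => x Ux.
by rewrite derive_entry//; exact: dM.
Qed.

Lemma derive_comp_coord V n (h : V -> 'rV[R]_n) (f : 'rV[R]_n -> R) x v :
  differentiable h x -> differentiable f (h x) ->
  'D_v (f \o h) x =
    \sum_a ('D_v (fun y => h y 0 a) x) * 'D_(delta_mx 0 a) f (h x).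
Proof.
move=> dhx dfx; rewrite deriveE; last exact: differentiable_comp.
rewrite diff_comp//= -(deriveE v dhx) (row_sum_delta ('D_v h x)) linear_sum.
by apply: eq_bigr => a _; rewrite linearZ/= derive_entry// -deriveE.
Qed.

Lemma C1_comp V n (U : set V) (B : set 'rV[R]_n) (h : V -> 'rV[R]_n)
    (f : 'rV[R]_n -> R) : open U -> (forall x, U x -> B (h x)) ->
  Ck 1 U h -> Ck 1 B f -> Ck 1 U (f \o h).
Proof.
move=> oU UB Ch [df Df]; have [dh Dh] := Ch; split => [x Ux|v].
  by apply: differentiable_comp; [exact: dh|exact/df/UB].
have E x : U x -> 'D_v (f \o h) x =
    \sum_a ('D_v (fun y => h y 0 a) x) * 'D_(delta_mx 0 a) f (h x).
  by move=> Ux; apply: derive_comp_coord; [exact: dh|exact/df/UB].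
apply: (@Ck_eq _ _ 0 U _ _ oU (fun x Ux => esym (E x Ux))).
apply: Ck_sum => // a _; apply: CkM => //.
  by have [_] := Ck_entry 0 a oU Ch; exact.
move=> x Ux; apply: (@continuous_comp _ _ _ h ('D_(delta_mx 0 a) f)).
  exact/differentiable_continuous/dh.
exact/Df/UB.
Qed.

Lemma Ck_scale V W k (U : set V) (f : V -> R) (w : W) :
  open U -> Ck k U f -> Ck k U (fun x => f x *: w).
Proof.
move=> oU; elim: k f => [|k IH] f.
  by move=> cf x Ux; apply: cvgZr_tmp; exact: cf.
move=> [df Df]; split => [x Ux|v].
  exact/differentiableZl/df.
apply: (Ck_eq oU _ (IH _ (Df v))) => x Ux.
have dfx := df x Ux; have dZ := differentiableZl w dfx.
by rewrite (deriveE v dfx) (deriveE v dZ) diffZl.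
Qed.

Lemma Ck_row V n k (U : set V) (f : V -> 'rV[R]_n) : open U ->
  (forall a, Ck k U (fun x => f x 0 a)) -> Ck k U f.
Proof.
move=> oU Cf; apply: (Ck_eq oU _ (Ck_sum (index_enum 'I_n) (P := xpredT) oU
  (fun a _ => Ck_scale (delta_mx 0 a : 'rV[R]_n) oU (Cf a)))) => x Ux.
by rewrite -row_sum_delta.
Qed.

Lemma Ck_det V m k (U : set V) (M : V -> 'M[R]_m) :
  open U -> (forall a b, Ck k U (fun x => M x a b)) ->
  Ck k U (fun x => \det (M x)).
Proof.
move=> oU CM.
have Cp (p : 'S_m) : Ck k U (fun x => (-1) ^+ p * \prod_a M x a (p a)).
  have Cprod := Ck_prod (index_enum 'I_m) (P := xpredT) oU
    (fun a _ => CM a (p a)).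
  exact: (CkM oU (@Ck_cst _ R k U _) Cprod).
exact: (Ck_sum (index_enum 'S_m) (P := xpredT) oU (fun p _ => Cp p)).
Qed.

Lemma Ck_det_jacobian n k (U : set 'rV[R]_n) (F : 'rV[R]_n -> 'rV[R]_n) :
  open U -> Ck k.+1 U F -> Ck k U (fun x => \det ('J F x)).
Proof.
move=> oU [dF DF]; apply: Ck_det => // a b.
have := Ck_entry 0 b oU (DF (delta_mx 0 a)).
apply: (Ck_eq oU) => x Ux; rewrite mxE deriveE//; exact: dF.
Qed.

Lemma continuous_bigsum (T : topologicalType) (I : Type) (r : seq I)
    (f : I -> T -> R) x : (forall a, {for x, continuous (f a)}) ->
  {for x, continuous (fun y => \sum_(a <- r) f a y)}.
Proof.
move=> cf; elim: r => [|a r IH].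
  rewrite (_ : (fun y => _) = fun=> 0); first exact: cvg_cst.
  by apply/funext => y; rewrite big_nil.
rewrite (_ : (fun y => _) = fun y => f a y + \sum_(b <- r) f b y).
  exact: cvgD (cf a) IH.
by apply/funext => y; rewrite big_cons.
Qed.

End CkBasics.

(** * Mean values and symmetry of second derivatives *)

Section MeanValue.
Context {R : realType} {V : normedModType R}.
Implicit Types (U : set V) (f g : V -> R) (x v w : V).

Lemma continuous_dist g x (e : R) : {for x, continuous g} -> 0 < e ->
  exists2 d, 0 < d & forall y, `|x - y| < d -> `|g x - g y| < e.
Proof.
move=> /cvgrPdist_lt cg e0; have /nbhs_ballP[d /= d0 dP] := cg e e0.
by exists d => // y xy; apply: dP; rewrite -ball_normE.
Qed.

Lemma open_dist U x : open U -> U x ->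
  exists2 d : R, 0 < d & forall y, `|x - y| < d -> U y.
Proof.
move=> oU Ux; have /nbhs_ballP[d /= d0 dP] := open_nbhs_nbhs (conj oU Ux).
by exists d => // y xy; apply: dP; rewrite -ball_normE.
Qed.

Lemma line_growth g x v (t : R) :
  (fun h : R => h^-1 *: (((fun s => g (x + s *: v)) \o shift t) (h *: 1) -
     g (x + t *: v))) =
  (fun h : R => h^-1 *: ((g \o shift (x + t *: v)) (h *: v) - g (x + t *: v))).
Proof.
apply/funext => h /=; congr (_ *: (g _ - _)).
by rewrite scalerDl [h%:A]mulr1 addrCA.
Qed.

Lemma is_derive_line g x v (t : R) : derivable g (x + t *: v) v ->
  is_derive t 1 (fun s => g (x + s *: v)) ('D_v g (x + t *: v)).
Proof.
move=> dg; apply: DeriveDef.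
  by rewrite /derivable line_growth.
by rewrite /derive line_growth.
Qed.

Lemma mean_value g x v (s : R) : 0 < s ->
  (forall t, 0 <= t <= s -> derivable g (x + t *: v) v) ->
  exists2 t, 0 < t < s & g (x + s *: v) - g x = s * 'D_v g (x + t *: v).
Proof.
move=> s0 dg.
have := @MVT R (fun t => g (x + t *: v)) (fun t => 'D_v g (x + t *: v)) 0 s s0.
case.
- move=> t; rewrite in_itv/= => /andP[t0 ts]; apply/is_derive_line/dg.
  by rewrite !ltW.
- apply: derivable_within_continuous => t; rewrite in_itv/= => t0s.
  by have [] := is_derive_line (dg t t0s).
- move=> t; rewrite in_itv/= scale0r addr0 subr0 mulrC => t0s E.
  by exists t.
Qed.

(** The left-hand side is symmetric in [v] and [w] while the right-hand side
    tends to a mixed derivative: this is why mixed derivatives agree. The mean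
    value theorem is applied twice: along [v] to the increment of [f] over
    [s *: w], then along [w]. *)
Lemma second_difference U f x v w (s : R) : 0 < s ->
  Ck 2 U f ->
  (forall a b, 0 <= a <= s -> 0 <= b <= s -> U (x + a *: v + b *: w)) ->
  exists a b, [/\ 0 <= a <= s, 0 <= b <= s &
    f (x + s *: v + s *: w) - f (x + s *: v) - f (x + s *: w) + f x =
    s * (s * 'D_w ('D_v f) (x + a *: v + b *: w))].
Proof.
move=> s0 [df Df] Us.
have [dDf _] := Df v.
pose g y := f (y + s *: w) - f y.
have s0' : 0 <= s <= s by rewrite lexx ltW.
have z0 : 0 <= (0 : R) <= s by rewrite lexx ltW.
have Ug t : 0 <= t <= s -> U (x + t *: v + s *: w) /\ U (x + t *: v).
  move=> ts; split; first exact: Us.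
  by have := Us t 0 ts z0; rewrite scale0r addr0.
have Dshift y : derivable f (y + s *: w) v ->
    derivable (fun z => f (z + s *: w)) y v /\
    'D_v (fun z => f (z + s *: w)) y = 'D_v f (y + s *: w).
  rewrite /derivable /derive => dfy.
  have -> : (fun h : R => h^-1 *:
      (((fun z => f (z + s *: w)) \o shift y) (h *: v) - f (y + s *: w))) =
    (fun h : R => h^-1 *:
      ((f \o shift (y + s *: w)) (h *: v) - f (y + s *: w))).
    by apply/funext => h /=; rewrite addrA.
  by [].
have Dg t : 0 <= t <= s -> derivable g (x + t *: v) v /\
    'D_v g (x + t *: v) = 'D_v f (x + t *: v + s *: w) - 'D_v f (x + t *: v).
  move=> /Ug[U1 U2].
  have [d1 E1] := Dshift _ (diff_derivable (v := v) (df _ U1)).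
  have d2 := diff_derivable (v := v) (df _ U2).
  split; first exact: derivableB d1 d2.
  by rewrite -E1 -deriveB.
have [a as_ Ea] := mean_value s0 (fun t ts => (Dg t ts).1).
have {}as_ : 0 <= a <= s by case/andP: as_ => ? ?; rewrite !ltW.
have [b bs Eb] := @mean_value ('D_v f) (x + a *: v) w s s0
  (fun b bs => diff_derivable (v := w) (dDf _ (Us _ _ as_ bs))).
exists a, b; split => //; first by case/andP: bs => ? ?; rewrite !ltW.
rewrite -Eb -(Dg a as_).2 -Ea /g; ring.
Qed.

Lemma derive_sym U f x v w : open U -> U x -> Ck 2 U f ->
  'D_w ('D_v f) x = 'D_v ('D_w f) x.
Proof.
move=> oU Ux Cf; apply/eqP; rewrite -subr_eq0 -normr_le0.
apply/ler_addgt0Pl => e e0; rewrite addr0.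
have cvw : {for x, continuous ('D_w ('D_v f))}.
  by have [_ Df] := Cf; have [_ DDf] := Df v; exact: DDf.
have cwv : {for x, continuous ('D_v ('D_w f))}.
  by have [_ Df] := Cf; have [_ DDf] := Df w; exact: DDf.
have e2 : 0 < e / 2 by rewrite divr_gt0.
have [d1 d10 P1] := continuous_dist cvw e2.
have [d2 d20 P2] := continuous_dist cwv e2.
have [d3 d30 P3] := open_dist oU Ux.
pose d := Num.min d1 (Num.min d2 d3).
have d0 : 0 < d by rewrite !lt_min d10 d20.
have dP y : `|x - y| < d ->
    [/\ U y, `|'D_w ('D_v f) x - 'D_w ('D_v f) y| < e / 2 &
        `|'D_v ('D_w f) x - 'D_v ('D_w f) y| < e / 2].
  rewrite !lt_min => /and3P[y1 y2 y3]; split.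
  - exact: P3.
  - exact: P1.
  - exact: P2.
(* so small that the parallelogram stays within distance [d] of [x] *)
pose s := d / (1 + `|v| + `|w|).
have c0 : 0 < 1 + `|v| + `|w| by rewrite -addrA ltr_wpDr// addr_ge0.
have s0 : 0 < s by rewrite divr_gt0.
have sd a b : 0 <= a <= s -> 0 <= b <= s -> `|x - (x + a *: v + b *: w)| < d.
  move=> /andP[a0 as_] /andP[b0 bs]; rewrite -addrA.
  rewrite opprD addNKr normrN.
  apply: le_lt_trans (ler_normD _ _) _; rewrite !normrZ !ger0_norm//.
  apply: (@le_lt_trans _ _ (s * (`|v| + `|w|))).
    by rewrite mulrDr lerD// ler_wpM2r.
  rewrite /s mulrAC ltr_pdivrMr// ltr_pM2l//; lra.
have Us a b : 0 <= a <= s -> 0 <= b <= s -> U (x + a *: v + b *: w).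
  by move=> ha hb; have [] := dP _ (sd a b ha hb).
have Us' a b : 0 <= a <= s -> 0 <= b <= s -> U (x + a *: w + b *: v).
  by move=> ha hb; rewrite addrAC; exact: Us.
have [a [b [ha hb E1]]] := second_difference s0 Cf Us.
have [a' [b' [ha' hb' E2]]] := second_difference s0 Cf Us'.
have [_ H1 _] := dP _ (sd _ _ ha hb).
have [_ _ H2] := dP _ (sd _ _ hb' ha'); rewrite addrAC in H2.
have E0 : f (x + s *: w + s *: v) = f (x + s *: v + s *: w).
  by congr (f _); exact: addrAC.
move: E1 E2 H1 H2; rewrite E0.
move: ('D_w ('D_v f) x) ('D_v ('D_w f) x) ('D_w ('D_v f) _) ('D_v ('D_w f) _).
move: (f _) (f _) (f _) (f _) => p q r t A B C D E1 E2 H1 H2.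
have CD : C = D.
  apply: (mulfI (lt0r_neq0 s0)); apply: (mulfI (lt0r_neq0 s0)).
  by rewrite -E1 -E2; ring.
rewrite -(subrKA C) (splitr e) ltW// (le_lt_trans (ler_normD _ _))// ltrD//.
by rewrite CD distrC.
Qed.

End MeanValue.

(** * Uniform estimates on compact sets *)

Lemma compact_unif_continuous {R : realType} {V : normedModType R}
    (K : set V) (g : V -> R) (e : R) : compact K ->
  (forall x, K x -> {for x, continuous g}) -> 0 < e ->
  exists2 d, 0 < d & forall x y, K x -> K y -> `|x - y| < d ->
    `|g x - g y| < e.
Proof.
move=> cK cg e0; have e2 : 0 < e / 2 by rewrite divr_gt0.
have := (@compact_near_coveringP V K).1 cK R (0^'+)
  (fun d x => forall y, `|x - y| < d -> `|g x - g y| < e) _.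
case=> [x Kx|].
  have /cvgrPdist_lt /(_ _ e2) /nbhs_ballP[r /= r0 rP] := cg x Kx.
  exists (ball x (r / 2), [set d | d < r / 2]).
    split => /=; first by apply: nbhsx_ballx; rewrite divr_gt0.
    by apply: nbhs_right_lt; rewrite divr_gt0.
  move=> [y d] /= [xy dr] z yz.
  have xz : ball x r z.
    rewrite (splitr r); apply: ball_triangle xy _.
    by rewrite -ball_normE /=; exact: lt_trans yz dr.
  have H1 := rP _ xz.
  have H2 : `|g x - g y| < e / 2.
    by apply: rP; apply: le_ball xy; lra.
  rewrite -(subrKA (g x)) (splitr e) (le_lt_trans (ler_normD _ _))//.
  by rewrite ltrD// distrC.
move=> r /= r0 H; exists (r / 2); first by rewrite divr_gt0.
move=> x y Kx Ky xy; apply: (H (r / 2)) => //=; last by rewrite divr_gt0.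
  by rewrite sub0r normrN gtr0_norm ?divr_gt0//; lra.
Qed.

(** The mean value theorem and the uniform continuity of the derivative make
    the error of the difference quotient uniform. *)
Lemma uniform_difference {R : realType} {V : normedModType R}
    (K W : set V) (g : V -> R) (v : V) (e : R) : compact K -> K `<=` W ->
  Ck 1 W g -> 0 < e ->
  exists2 d, 0 < d & forall x s, 0 < s -> s < d ->
    (forall t, 0 <= t <= s -> K (x + t *: v)) ->
    `|g (x + s *: v) - g x - s * 'D_v g x| <= s * e.
Proof.
move=> cK KW [dg Dg] e0.
have cDg x : K x -> {for x, continuous ('D_v g)} by move=> /KW; exact: Dg.
have [d d0 dP] := compact_unif_continuous cK cDg e0.
have c0 : 0 < 1 + `|v| by rewrite ltr_wpDr.
exists (d / (1 + `|v|)); first by rewrite divr_gt0.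
move=> x s s0 sd Ks.
have [t /andP[t0 ts] ->] :=
  mean_value s0 (fun t ts => diff_derivable (v := v) (dg _ (KW _ (Ks t ts)))).
have Kx : K x by have := Ks 0; rewrite scale0r addr0; apply; rewrite lexx ltW.
rewrite -mulrBr normrM gtr0_norm// ler_pM2l// ltW//; apply: dP => //.
  by apply: Ks; rewrite !ltW.
rewrite addrAC subrr add0r normrZ gtr0_norm//.
move: sd; rewrite ltr_pdivlMr// => sd; apply: le_lt_trans sd.
rewrite mulrDr mulr1 -[leLHS]add0r lerD// ?(ltW s0)//.
by apply: ler_wpM2r => //; exact: ltW.
Qed.

(** * Jacobian determinants are divergences *)

Section NullLagrangian.
Context {R : realType} {V : normedModType R}.
Implicit Types (x v : V).

Lemma is_derive_bigsum (I : Type) (r : seq I) (f : I -> V -> R) (df : I -> R)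
    x v : (forall i, is_derive x v (f i) (df i)) ->
  is_derive x v (fun y => \sum_(i <- r) f i y) (\sum_(i <- r) df i).
Proof.
move=> fP; elim: r => [|i r IH].
  rewrite (_ : (fun y => _) = cst 0); last first.
    by apply/funext => y; rewrite big_nil.
  by rewrite big_nil; exact: is_derive_cst.
rewrite (_ : (fun y => _) = f i + (fun y => \sum_(j <- r) f j y)).
  by rewrite big_cons; exact: is_deriveD.
by apply/funext => y; rewrite big_cons.
Qed.

Lemma is_derive_bigprod (I : eqType) (r : seq I) (f : I -> V -> R)
    (df : I -> R) x v : uniq r -> (forall i, is_derive x v (f i) (df i)) ->
  is_derive x v (fun y => \prod_(i <- r) f i y)
    (\sum_(i <- r) df i * \prod_(j <- r | j != i) f j x).
Proof.
move=> + fP; elim: r => [_|i r IH /= /andP[ir ur]].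
  rewrite (_ : (fun y => _) = cst 1); last first.
    by apply/funext => y; rewrite big_nil.
  by rewrite big_nil; exact: is_derive_cst.
rewrite (_ : (fun y => _) = f i * (fun y => \prod_(j <- r) f j y)); last first.
  by apply/funext => y; rewrite big_cons.
apply: (is_derive_eq (is_deriveM (fP i) (IH ur))).
rewrite [RHS]big_cons big_cons eqxx /= addrC; congr (_ + _).
  rewrite /GRing.scale/= mulrC; congr (_ * _).
  rewrite [LHS]big_seq [RHS]big_seq_cond [LHS]big_mkcond [RHS]big_mkcond.
  apply: eq_bigr => j _ /=; case: ifP => //= jr.
  by rewrite (memPn ir)// jr.
rewrite /GRing.scale/= mulr_sumr [LHS]big_seq [RHS]big_seq.
apply: eq_bigr => j jr; rewrite big_cons (_ : i != j).
  by rewrite mulrCA.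
by apply: contraNneq ir => ->.
Qed.

Context {m : nat} (e : 'I_m.+1 -> V) (u : 'I_m.+1 -> V -> R).

(** The component in the direction [e i] is [u 0] times a maximal minor of the
    derivative of the other components of [u], with its sign; as a determinant
    it has a Leibniz expansion that treats all directions alike. *)
Definition minor_field (i : 'I_m.+1) (y : V) : R :=
  \det (\matrix_(a, j) if a == 0 then (j == i)%:R * u 0 y
                       else 'D_(e j) (u a) y).

Let q (a j : 'I_m.+1) : V -> R := if a == 0 then u 0 else 'D_(e j) (u a).

Lemma minor_fieldE i y : minor_field i y =
  \sum_(s : 'S_m.+1) ((-1) ^+ s * (s 0 == i)%:R) * \prod_a q a (s a) y.
Proof.
apply: eq_bigr => s _; rewrite -mulrA; congr (_ * _).
rewrite (bigD1 0)//= [in RHS](bigD1 0)//= mxE eqxx mulrA; congr (_ * _).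
by apply: eq_bigr => a /negbTE a0; rewrite mxE a0 /q a0.
Qed.

(** A Jacobian determinant is a divergence: after the Leibniz expansion, the
    terms with a second derivative of [u b] are antisymmetric under exchanging
    the indices that the permutation assigns to [0] and to [b], so they cancel;
    what is left is the Leibniz expansion of the Jacobian determinant. *)
Lemma div_minor_field x :
  (forall i, derivable (u 0) x (e i)) ->
  (forall a i j, a != 0 -> derivable ('D_(e j) (u a)) x (e i)) ->
  (forall a i j, a != 0 ->
     'D_(e i) ('D_(e j) (u a)) x = 'D_(e j) ('D_(e i) (u a)) x) ->
  \sum_i 'D_(e i) (minor_field i) x = \det (\matrix_(a, j) 'D_(e j) (u a) x).
Proof.
move=> d0 d1 sym.
have qP a j i : is_derive x (e i) (q a j) ('D_(e i) (q a j) x).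
  by apply: derivableP; rewrite /q; case: eqVneq => // a0; exact: d1.
have E i : 'D_(e i) (minor_field i) x = \sum_(s : 'S_m.+1)
    ((-1) ^+ s * (s 0 == i)%:R) *
    \sum_b 'D_(e i) (q b (s b)) x * \prod_(a | a != b) q a (s a) x.
  rewrite (_ : minor_field i = fun y => \sum_(s : 'S_m.+1)
      ((-1) ^+ s * (s 0 == i)%:R) * \prod_a q a (s a) y); last first.
    by apply/funext => y; exact: minor_fieldE.
  apply: derive_val; apply: is_derive_bigsum => s.
  have := is_derive_bigprod (index_enum_uniq _) (fun a => qP a (s a) i).
  exact: (@is_deriveZ _ _ _ _ _ _ _ _).
under eq_bigr do rewrite E.
rewrite exchange_big /=.
have {}E (s : 'S_m.+1) : \sum_i ((-1) ^+ s * (s 0 == i)%:R) *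
    \sum_b 'D_(e i) (q b (s b)) x * \prod_(a | a != b) q a (s a) x =
    \sum_b (-1) ^+ s *
      ('D_(e (s 0)) (q b (s b)) x * \prod_(a | a != b) q a (s a) x).
  rewrite (bigD1 (s 0))//= eqxx mulr1 [X in _ + X]big1 ?addr0 ?mulr_sumr//.
  by move=> i /negbTE; rewrite eq_sym => ->; rewrite mulr0 mul0r.
under eq_bigr do rewrite E.
rewrite exchange_big /= (bigD1 0)//= [X in _ + X]big1 ?addr0 => [|b b0].
  apply: eq_bigr => s _; congr (_ * _); rewrite [RHS](bigD1 0)//= mxE.
  congr (_ * _); apply: eq_bigr => a /negbTE a0.
  by rewrite /q a0 mxE.
set S := (X in X = 0).
suff : S = - S.
  by move/eqP; rewrite -addr_eq0 -mulr2n mulrn_eq0/= => /eqP.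
rewrite {1}/S (reindex_inj (mulgI (tperm 0 b))) /= /S -sumrN.
apply: eq_bigr => s _; rewrite odd_mul_tperm eq_sym b0 addTb signrN mulNr.
congr (- (_ * _)); rewrite !permM tpermL tpermR.
have -> : 'D_(e (s b)) (q b (s 0)) x = 'D_(e (s 0)) (q b (s b)) x.
  by rewrite /q (negbTE b0); exact: sym.
congr (_ * _); apply: eq_bigr => a ab; rewrite permM /q.
have [//|a0] := eqVneq a 0.
by rewrite tpermD// eq_sym.
Qed.

End NullLagrangian.

(** * Cubes and sums over grids *)

Section Grid.
Context {R : realType} {n : nat}.
Implicit Types (c x : 'rV[R]_n) (r : R) (N : nat).

Lemma rV_entry_le x a : `|x 0 a| <= `|x|.
Proof.
rewrite [leRHS]/Num.Def.normr/= mx_normrE.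
exact: (le_bigmax _ _ (0, a)).
Qed.

Lemma rV_norm_lt x (e : R) : 0 < e -> (forall a, `|x 0 a| < e) -> `|x| < e.
Proof.
move=> e0 xe; rewrite [ltLHS]/Num.Def.normr/= mx_normrE.
by apply/bigmax_ltP; split => // -[i a] _ /=; rewrite ord1.
Qed.

Lemma rV_norm_le x (e : R) : 0 <= e -> (forall a, `|x 0 a| <= e) -> `|x| <= e.
Proof.
move=> e0 xe; rewrite [leLHS]/Num.Def.normr/= mx_normrE.
by apply/bigmax_leP; split => // -[i a] _ /=; rewrite ord1.
Qed.

Definition cube c r : set 'rV[R]_n := [set x | forall a, `|x 0 a - c 0 a| <= r].

Lemma cube_norm c r x : 0 <= r ->
  cube c r x <-> `|x - c| <= r.
Proof.
move=> r0; split => [cx|xr a].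
  by apply: rV_norm_le => // a; rewrite !mxE.
by apply: le_trans xr; have := rV_entry_le (x - c) a; rewrite !mxE.
Qed.

Lemma cube_compact c r : compact (cube c r).
Proof.
rewrite (_ : cube c r = [set v : 'rV[R]_n |
    forall a, `[c 0 a - r, c 0 a + r]%classic (v 0 a)]).
  apply: (@rV_compact _ _ (fun a => `[c 0 a - r, c 0 a + r]%classic)) => a.
  exact: segment_compact.
by apply/seteqP; split => x /= cx a; have := cx a; rewrite ler_distl in_itv.
Qed.

Definition grid N := {ffun 'I_n -> 'I_N.+1}.

Definition grid_step r N : R := 2 * r / N.+1%:R.

(** The cube is cut into [N.+1] slabs in each direction, and a cell is
    represented by its corner with the smallest coordinates; no grid point lies
    on the face where a coordinate is maximal. *)
Definition grid_pt c r N (z : grid N) : 'rV[R]_n :=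
  \row_a (c 0 a - r + grid_step r N * (z a)%:R).

Lemma grid_step_gt0 r N : 0 < r -> 0 < grid_step r N.
Proof. by move=> r0; rewrite divr_gt0 ?mulr_gt0. Qed.

Lemma grid_step_small r d : 0 < d -> \forall N \near \oo, grid_step r N < d.
Proof.
move=> d0; have := @near_infty_natSinv_lt R.
have [r0|r0] := leP r 0.
  move=> _; near=> N; apply: le_lt_trans d0.
  by rewrite /grid_step -mulrA pmulr_rle0// mulr_le0_ge0.
have e0 : 0 < d / (2 * r) by rewrite divr_gt0// mulr_gt0.
move=> /(_ (PosNum e0)); apply: filterS => N /=.
by rewrite ltr_pdivlMr ?mulr_gt0// mulrC.
Unshelve. all: by end_near. Qed.

Lemma grid_step_last r N : grid_step r N * N.+1%:R = 2 * r.
Proof. by rewrite /grid_step divfK. Qed.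

Lemma grid_pt_cube c r N (z : grid N) (t : R) i : 0 < r ->
  0 <= t <= grid_step r N -> cube c r (grid_pt c r z + t *: delta_mx 0 i).
Proof.
move=> r0 /andP[t0 tr] a; rewrite !mxE eqxx/= ler_norml.
have s0 := grid_step_gt0 N r0.
have z0 : 0 <= grid_step r N * (z a)%:R :> R by rewrite mulr_ge0// ltW.
have H : 0 <= t * (a == i)%:R <= grid_step r N.
  by case: eqP; rewrite ?mulr1 ?mulr0 ?t0 ?tr// lexx ltW.
have zN : grid_step r N * (z a)%:R + grid_step r N <= 2 * r :> R.
  rewrite -(grid_step_last r N) -[X in _ + X <= _]mulr1 -mulrDr ler_pM2l//.
  by rewrite natr1 ler_nat.
move: H => /andP[]; move: zN z0; lra.
Qed.

Definition grid_shift N (i : 'I_n) (z : grid N) : grid N :=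
  [ffun a => if a == i then ordS (z a) else z a].

Lemma grid_shift_inj N i : injective (@grid_shift N i).
Proof.
move=> z z' /ffunP zz'; apply/ffunP => a; have := zz' a; rewrite !ffunE.
by case: eqP => // _; exact: ordS_inj.
Qed.

(** Moving every grid point one step in the direction [i] permutes the grid
    cyclically, except that the last layer arrives on the face opposite to the
    first one; [g] vanishes on both. *)
Lemma grid_sum_shift c r N i (g : 'rV[R]_n -> R) : 0 < r ->
  (forall x, cube c r x -> `|x 0 i - c 0 i| = r -> g x = 0) ->
  \sum_(z : grid N) g (grid_pt c r z + grid_step r N *: delta_mx 0 i) =
  \sum_(z : grid N) g (grid_pt c r z).
Proof.
move=> r0 g0; rewrite [RHS](reindex_inj (@grid_shift_inj N i)).
have s0 := grid_step_gt0 N r0.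
have gc z t (ht : 0 <= t <= grid_step r N) := @grid_pt_cube c r N z t i r0 ht.
apply: eq_bigr => z _; have := ltn_ord (z i); rewrite ltnS leq_eqVlt.
case/orP => [/eqP zN|zN].
  rewrite g0 ?g0//.
  - have := gc (grid_shift i z) 0; rewrite scale0r addr0; apply.
    by rewrite lexx ltW.
  - rewrite mxE ffunE eqxx /= zN modnn mulr0 addr0.
    by rewrite addrAC subrr add0r normrN gtr0_norm.
  - by apply: gc; rewrite lexx ltW.
  - have E : grid_step r N * N%:R + grid_step r N = 2 * r :> R.
      by rewrite -(grid_step_last r N) -natr1 mulrDr mulr1.
    rewrite !mxE zN !eqxx mulr1 (_ : _ - _ = r) ?gtr0_norm//.
    by move: E; lra.
congr g; apply/rowP => a; rewrite !mxE ffunE eqxx /=.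
have [->|ai] := eqVneq a i; last by rewrite mulr0 addr0.
by rewrite /= modn_small// mulr1 -natr1 mulrDr mulr1 addrA.
Qed.

Lemma grid_pt_in c r N (z : grid N) : 0 < r -> cube c r (grid_pt c r z).
Proof.
move=> r0 a; rewrite mxE ler_norml.
have s0 := grid_step_gt0 N r0.
have z0 : 0 <= grid_step r N * (z a)%:R :> R by rewrite mulr_ge0// ltW.
have zN : grid_step r N * (z a)%:R <= 2 * r :> R.
  by rewrite -(grid_step_last r N) ler_pM2l// ler_nat ltnW.
by move: zN z0; lra.
Qed.

End Grid.
Arguments grid : clear implicits.

(** * Homotopy invariance of grid sums *)

Section Slices.
Context {R : realType} {n : nat}.
Implicit Types (c x : 'rV[R]_n) (r t : R).

(** In [R^(1+n)], the coordinate of index [0] is the time. *)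
Definition slice t x : 'rV[R]_(1 + n) := row_mx t%:M x.

Lemma slice0 t x : slice t x 0 0 = t.
Proof.
have -> : (0 : 'I_(1 + n)) = lshift n 0 by apply: val_inj.
by rewrite row_mxEl mxE eqxx.
Qed.

Lemma slice_lift t x a : slice t x 0 (lift 0 a) = x 0 a.
Proof. by rewrite -rshift1 row_mxEr. Qed.

Lemma rsubmx_slice t x : rsubmx (slice t x) = x.
Proof. exact: row_mxKr. Qed.

Lemma slice_shift t x s (v : 'rV[R]_n) :
  slice t (x + s *: v) = slice t x + s *: row_mx 0 v.
Proof.
by rewrite /slice scale_row_mx scaler0 add_row_mx addr0.
Qed.

Lemma delta_lift a :
  delta_mx 0 (lift 0 a) = row_mx 0 (delta_mx 0 a) :> 'rV[R]_(1 + n).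
Proof.
apply/rowP => j; rewrite mxE eqxx /=; case: (unliftP 0 j) => [b ->|->].
  by rewrite -rshift1 row_mxEr mxE eqxx /= rshift1 (inj_eq lift_inj).
have -> : (0 : 'I_(1 + n)) = lshift n 0 by apply: val_inj.
by rewrite row_mxEl mxE.
Qed.

Lemma slice_time t x : slice t x = slice 0 x + t *: delta_mx 0 0.
Proof.
apply/rowP => j; rewrite [RHS]mxE; case: (unliftP 0 j) => [b ->|->].
  by rewrite !slice_lift !mxE /= mulr0 addr0.
by rewrite !slice0 !mxE eqxx add0r mulr1.
Qed.

Lemma derive_slice (g : 'rV[R]_(1 + n) -> R) t x v :
  'D_(row_mx 0 v) g (slice t x) = 'D_v (fun y => g (slice t y)) x.
Proof.
rewrite /derive; set d := (fun _ : R => _); set d' := (fun _ : R => _).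
suff -> : d = d' by [].
apply/funext => h; rewrite /d /d' /=; congr (_ *: (g _ - _)).
by rewrite addrC -slice_shift addrC.
Qed.

Definition box (c : 'rV[R]_n) r : set 'rV[R]_(1 + n) :=
  [set s : 'rV[R]_(1 + n) | 0 <= s 0 0 <= 1 /\ cube c r (rsubmx s)].

Lemma box_slice c r t x : 0 <= t <= 1 -> cube c r x -> box c r (slice t x).
Proof. by move=> t01 cx; split; [rewrite slice0|rewrite rsubmx_slice]. Qed.

Lemma box_compact c r : compact (box c r).
Proof.
pose A (j : 'I_(1 + n)) : set R := if unlift 0 j is Some a
  then `[c 0 a - r, c 0 a + r]%classic else `[0, 1]%classic.
rewrite (_ : box c r = [set s : 'rV[R]_(1 + n) | forall j, A j (s 0 j)]).
  by apply: rV_compact => j; rewrite /A; case: unlift => [a|];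
    exact: segment_compact.
apply/seteqP; split => s /=.
  move=> [s0 sc] j; rewrite /A; case: unliftP => [a ->|->] /=.
    have := sc a; rewrite mxE rshift1 ler_distl in_itv/= => /andP[].
    by move=> -> ->.
  by rewrite in_itv.
move=> As; split.
  by have := As 0; rewrite /A unlift_none /= in_itv.
move=> a; have := As (lift 0 a); rewrite /A liftK /= in_itv/= mxE rshift1.
by rewrite ler_distl.
Qed.

(** The counterpart of the vanishing of the integral of a derivative: up to a
    uniform error, the derivative is a difference quotient, whose grid sum is
    zero by [grid_sum_shift]. *)
Lemma grid_sum_derive c r (W : set 'rV[R]_(1 + n))
    (g : 'rV[R]_(1 + n) -> R) (i : 'I_n) (e : R) :
  0 < r -> box c r `<=` W -> Ck 1 W g ->
  (forall t x, 0 <= t <= 1 -> cube c r x -> `|x 0 i - c 0 i| = r ->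
     g (slice t x) = 0) ->
  0 < e ->
  \forall N \near \oo, forall t, 0 <= t <= 1 ->
    `|\sum_(z : grid n N)
        'D_(delta_mx 0 (lift 0 i)) g (slice t (grid_pt c r z))| <=
    e * #|grid n N|%:R.
Proof.
move=> r0 KW Cg gface e0.
have [d d0 dP] := uniform_difference (delta_mx 0 (lift 0 i))
  (@box_compact c r) KW Cg e0.
apply: filterS (grid_step_small r d0) => N Nd t t01.
have s0 := grid_step_gt0 N r0; set s := grid_step r N in Nd s0 *.
pose D (z : grid n N) : R :=
  'D_(delta_mx 0 (lift 0 i)) g (slice t (grid_pt c r z)).
pose G (z : grid n N) : R := g (slice t (grid_pt c r z)).
pose G' (z : grid n N) : R := g (slice t (grid_pt c r z + s *: delta_mx 0 i)).
have Hz (z : grid n N) : `|G' z - G z - s * D z| <= s * e.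
  rewrite /G' /G /D slice_shift -delta_lift; apply: dP => // u us.
  rewrite delta_lift -slice_shift; apply: box_slice => //.
  exact: grid_pt_cube.
have GG' : \sum_z G' z = \sum_z G z.
  apply: (@grid_sum_shift _ _ c r N i (fun x => g (slice t x))) => // x cx xi.
  exact: gface.
have E : \sum_z (G' z - G z - s * D z) = - (s * \sum_z D z).
  by rewrite sumrB sumrB GG' subrr add0r mulr_sumr.
have : `|s * \sum_z D z| <= \sum_(z : grid n N) s * e.
  rewrite -normrN -E; apply: le_trans (ler_norm_sum _ _ _) _.
  by apply: ler_sum => z _.
rewrite sumr_const normrM gtr0_norm// -[_ *+ #|_|]mulr_natr -mulrA.
by rewrite ler_pM2l.
Qed.

(** For a field [V] without divergence, the time derivative of the grid sum of
    [V 0] is minus the grid sum of the spatial derivatives of the other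
    components, which is almost zero by [grid_sum_derive]; the mean value
    theorem in time concludes. *)
Lemma grid_sum_divergence c r (W : set 'rV[R]_(1 + n))
    (V : 'I_(1 + n) -> 'rV[R]_(1 + n) -> R) (e : R) :
  0 < r -> box c r `<=` W -> (forall i, Ck 1 W (V i)) ->
  (forall t x i, 0 <= t <= 1 -> cube c r x -> `|x 0 i - c 0 i| = r ->
     V (lift 0 i) (slice t x) = 0) ->
  (forall s, W s -> \sum_i 'D_(delta_mx 0 i) (V i) s = 0) ->
  0 < e ->
  \forall N \near \oo,
    `|\sum_(z : grid n N) (V 0 (slice 1 (grid_pt c r z)) -
                           V 0 (slice 0 (grid_pt c r z)))| <=
    e * #|grid n N|%:R.
Proof.
move=> r0 KW CV Vface divV e0.
have e'0 : 0 < e / n.+1%:R by rewrite divr_gt0.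
have : \forall N \near \oo, forall i : 'I_n, forall t, 0 <= t <= 1 ->
    `|\sum_(z : grid n N)
        'D_(delta_mx 0 (lift 0 i)) (V (lift 0 i)) (slice t (grid_pt c r z))| <=
    e / n.+1%:R * #|grid n N|%:R.
  apply: filter_forall => i; apply: grid_sum_derive r0 KW _ _ e'0.
    exact: CV.
  by move=> t x; exact: Vface.
apply: filterS => N HN.
pose phi t := \sum_(z : grid n N)
  V 0 (slice 0 (grid_pt c r z) + t *: delta_mx 0 0).
pose dphi t := \sum_(z : grid n N)
  'D_(delta_mx 0 0) (V 0) (slice 0 (grid_pt c r z) + t *: delta_mx 0 0).
have zW t (z : grid n N) : 0 <= t <= 1 -> W (slice t (grid_pt c r z)).
  by move=> t01; apply/KW/box_slice => //; exact: grid_pt_in.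
have phiP t : 0 <= t <= 1 -> is_derive t (1 : R) phi (dphi t).
  move=> t01; apply: is_derive_bigsum => z; apply: is_derive_line.
  apply: diff_derivable; rewrite -slice_time; have [dV _] := CV 0.
  exact/dV/zW.
have [||t] := @MVT R phi dphi 0 1 ltr01.
- by move=> t; rewrite in_itv/= => /andP[? ?]; apply: phiP; rewrite !ltW.
- apply: derivable_within_continuous => t; rewrite in_itv/= => t01.
  by have [] := phiP t t01.
rewrite in_itv/= => /andP[t0 t1].
have t01 : 0 <= t <= 1 by rewrite !ltW.
rewrite subr0 mulr1 => E.
have -> : \sum_(z : grid n N) (V 0 (slice 1 (grid_pt c r z)) -
    V 0 (slice 0 (grid_pt c r z))) = dphi t.
  rewrite -E /phi sumrB; congr (_ - _); apply: eq_bigr => z _.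
    by rewrite [in LHS]slice_time.
  by rewrite scale0r addr0.
have -> : dphi t = - \sum_(i < n) \sum_(z : grid n N)
    'D_(delta_mx 0 (lift 0 i)) (V (lift 0 i)) (slice t (grid_pt c r z)).
  rewrite exchange_big -sumrN; apply: eq_bigr => z _.
  rewrite -slice_time; apply/eqP; rewrite -addr_eq0; apply/eqP.
  by have := divV _ (zW t z t01); rewrite big_ord_recl.
rewrite normrN; apply: le_trans (ler_norm_sum _ _ _) _.
apply: (@le_trans _ _ (\sum_(i < n) e / n.+1%:R * #|grid n N|%:R)).
  by apply: ler_sum => i _; exact: HN.
rewrite sumr_const card_ord -[_ *+ n]mulr_natl mulrA; apply: ler_wpM2r => //.
by rewrite mulrCA ger_pMr// ler_pdivrMr// mul1r ler_nat.
Qed.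

End Slices.

Section Homotopy.
Context {R : realType} {n : nat}.
Variables (U B : set 'rV[R]_n) (F G : 'rV[R]_n -> 'rV[R]_n).
Variable f : 'rV[R]_n -> R.
Hypotheses (oU : open U) (CF : Ck 2 U F) (CG : Ck 2 U G).
Hypotheses (oB : open B) (Cf : Ck 1 B f).

Definition segment_map t x : 'rV[R]_n := F x + t *: (G x - F x).

Let h (s : 'rV[R]_(1 + n)) : 'rV[R]_n := segment_map (s 0 0) (rsubmx s).

(** The map [(f o h, h)] from [R^(1+n)] to itself. *)
Let u (i : 'I_(1 + n)) (s : 'rV[R]_(1 + n)) : R :=
  if unlift 0 i is Some a then h s 0 a else f (h s).

Let e (i : 'I_(1 + n)) : 'rV[R]_(1 + n) := delta_mx 0 i.

Let U1 : set 'rV[R]_(1 + n) := rsubmx @^-1` U.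
Let W := U1 `&` h @^-1` B.

Let oU1 : open U1.
Proof. by apply: open_comp => // x _; exact: continuous_rsubmx. Qed.

Let Ch a : Ck 2 U1 (fun s => h s 0 a).
Proof.
have Clin (k : 'rV[R]_n -> 'rV[R]_n) : Ck 2 U k ->
    Ck 2 U1 (fun s => k (rsubmx s) 0 a).
  move=> Ck2; apply: (Ck_entry (M := k \o rsubmx)) => //.
  exact: (@Ck_comp_lin R _ _ _ 2 U (@rsubmx R 1 1 n : {linear _ -> _}) k
    (@continuous_rsubmx _ _ _ _) Ck2).
have Ct : Ck 2 U1 (fun s : 'rV[R]_(1 + n) => s 0 0).
  apply: (Ck_entry (M := id)) => //.
  by apply: (@Ck_lin _ _ _ 2 U1 idfun) => x; exact: cvg_id.
have := CkD oU1 (Clin _ CF) (CkM oU1 Ct (CkB oU1 (Clin _ CG) (Clin _ CF))).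
by apply: (Ck_eq oU1) => s _; rewrite /h /segment_map !mxE.
Qed.

Let Ch' : Ck 2 U1 h. Proof. exact: Ck_row. Qed.

Let oW : open W.
Proof.
have ch := Ck_continuous Ch'.
by apply: open_preimage oU1 oB _ => s Us; exact: ch.
Qed.

Let WU1 : W `<=` U1. Proof. by move=> s []. Qed.

Let Cu0 : Ck 1 W (u 0).
Proof.
have ChW : Ck 1 W h by exact/(Ck_sub WU1)/CkW/Ch'.
have := @C1_comp _ _ _ W B h f oW (fun s Ws => Ws.2) ChW Cf.
by apply: (Ck_eq oW) => s _; rewrite /u unlift_none.
Qed.

Let Cua a : Ck 2 W (u (lift 0 a)).
Proof.
have := Ck_sub WU1 (Ch a).
by apply: (Ck_eq oW) => s _; rewrite /u liftK.
Qed.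

Let Cu i : i != 0 -> Ck 2 W (u i).
Proof.
by case: (unliftP 0 i) => [a ->|->]; rewrite ?eqxx// => _; exact: Cua.
Qed.

(** By the chain rule, the first row of the Jacobian matrix is a combination of
    the other rows. *)
Let jacobian_degenerate s : W s -> \det (\matrix_(a, j) 'D_(e j) (u a) s) = 0.
Proof.
move=> Ws; apply/eqP/det0P.
exists (\row_i if unlift 0 i is Some a then 'D_(delta_mx 0 a) f (h s) else -1).
  apply/eqP => /rowP/(_ 0)/eqP; rewrite !mxE unlift_none oppr_eq0.
  by rewrite (negbTE (oner_neq0 _)).
apply/rowP => j; rewrite !mxE big_ord_recl !mxE unlift_none mulN1r.
apply/eqP; rewrite addrC subr_eq0; apply/eqP.
have -> : u 0 = f \o h by apply/funext => y; rewrite /u unlift_none.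
have [Us Bs] := Ws.
have dh : differentiable h s by have [dh _] := Ch'; exact: dh.
have df : differentiable f (h s) by have [df _] := Cf; exact: df.
rewrite derive_comp_coord//; apply: eq_bigr => a _.
have -> : (fun y => h y 0 a) = u (lift 0 a).
  by apply/funext => y; rewrite /u liftK.
by rewrite !mxE liftK mulrC.
Qed.

Let V i := minor_field e u i.

Let CV i : Ck 1 W (V i).
Proof.
pose q (a j : 'I_(1 + n)) := if a == 0 then u 0 else 'D_(e j) (u a).
have Cq a j : Ck 1 W (q a j).
  rewrite /q; case: (eqVneq a 0) => [_|a0]; first exact: Cu0.
  by have [_ Du] := Cu a0; exact: Du.
have Cp (p : 'S_(1 + n)) : Ck 1 W (fun s =>
    ((-1) ^+ p * (p 0 == i)%:R) * \prod_a q a (p a) s).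
  have Cprod := Ck_prod (index_enum 'I_(1 + n)) (P := xpredT) oW
    (fun a _ => Cq a (p a)).
  exact: (CkM oW (@Ck_cst _ _ R 1 W _) Cprod).
have := Ck_sum (index_enum 'S_(1 + n)) (P := xpredT) oW (fun p _ => Cp p).
by apply: (Ck_eq oW) => s _; rewrite /V minor_fieldE.
Qed.

Let divV s : W s -> \sum_i 'D_(delta_mx 0 i) (V i) s = 0.
Proof.
move=> Ws; rewrite -[RHS](jacobian_degenerate Ws); apply: div_minor_field.
- by move=> i; apply: diff_derivable; have [du _] := Cu0; exact: du.
- move=> a i j a0; apply: diff_derivable; have [_ Du] := Cu a0.
  by have [dDu _] := Du (e j); exact: dDu.
- by move=> a i j a0; exact: (derive_sym (e j) (e i) oW Ws (Cu a0)).
Qed.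

Let V_eq0 i s : f (h s) = 0 -> V i s = 0.
Proof.
move=> fh0; rewrite /V /minor_field (expand_det_row _ 0) big1// => j _.
by rewrite mxE eqxx /u unlift_none fh0 mulr0 mul0r.
Qed.

Let hslice t x : h (slice t x) = segment_map t x.
Proof. by rewrite /h slice0 rsubmx_slice. Qed.

Let V_slice t x : differentiable (segment_map t) x ->
  V 0 (slice t x) = f (segment_map t x) * \det ('J (segment_map t) x).
Proof.
move=> dS; rewrite /V /minor_field (expand_det_row _ 0) big_ord_recl.
rewrite [X in _ + X]big1 ?addr0 => [|j _]; last by rewrite mxE !mul0r.
rewrite mxE eqxx mul1r {1}/u unlift_none hslice; congr (_ * _).
rewrite /cofactor expr0 mul1r -[RHS]det_tr; congr (\det _).
apply/matrixP => a b; rewrite !mxE /=.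
rewrite /e delta_lift derive_slice.
have -> : (fun y => u (lift 0 a) (slice t y)) = fun y => segment_map t y 0 a.
  by apply/funext => y; rewrite /u liftK hslice.
rewrite derive_entry// deriveE// mxE.
Qed.

(** The values of the time component at times 0 and 1 are the two weighted
    Jacobian determinants ([V_slice]), and the field has no divergence
    ([divV]). *)
Lemma homotopy_grid_sum c r (eps : R) : 0 < r -> cube c r `<=` U ->
  (forall t x, 0 <= t <= 1 -> cube c r x -> B (segment_map t x)) ->
  (forall t x i, 0 <= t <= 1 -> cube c r x -> `|x 0 i - c 0 i| = r ->
     f (segment_map t x) = 0) ->
  0 < eps ->
  \forall N \near \oo,
    `|\sum_(z : grid n N)
        (f (G (grid_pt c r z)) * \det ('J G (grid_pt c r z)) -
         f (F (grid_pt c r z)) * \det ('J F (grid_pt c r z)))| <=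
    eps * #|grid n N|%:R.
Proof.
move=> r0 cU cB cf eps0.
have KW : box c r `<=` W.
  by move=> s [t01 cs]; split; [exact: cU|exact: cB].
have Vface t x i : 0 <= t <= 1 -> cube c r x -> `|x 0 i - c 0 i| = r ->
    V (lift 0 i) (slice t x) = 0.
  by move=> t01 cx xi; apply: V_eq0; rewrite hslice; exact: cf xi.
apply: filterS (grid_sum_divergence r0 KW CV Vface divV eps0) => N.
suff -> : \sum_(z : grid n N) (V 0 (slice 1 (grid_pt c r z)) -
    V 0 (slice 0 (grid_pt c r z))) = \sum_(z : grid n N)
    (f (G (grid_pt c r z)) * \det ('J G (grid_pt c r z)) -
     f (F (grid_pt c r z)) * \det ('J F (grid_pt c r z))) by [].
have E0 : segment_map 0 = F.
  by apply/funext => x; rewrite /segment_map scale0r addr0.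
have E1 : segment_map 1 = G.
  by apply/funext => x; rewrite /segment_map scale1r addrC subrK.
apply: eq_bigr => z _; have Uz : U (grid_pt c r z) by exact/cU/grid_pt_in.
have [dF _] := CF; have [dG _] := CG.
by rewrite !V_slice ?E0 ?E1//; [exact: dF|exact: dG].
Qed.

End Homotopy.

(** * Bump functions *)

Section Bump.
Context {R : realType}.

(** The simplest C^1 function that vanishes exactly on a half-line. *)
Definition sqr_pos (s : R) : R := Num.max 0 s ^+ 2.

Lemma max0_cases (s : R) :
  (0 <= s /\ Num.max 0 s = s) \/ (s <= 0 /\ Num.max 0 s = 0).
Proof. by have [s0|/ltW s0] := leP 0 s; [left|right]; split. Qed.

Lemma sqr_pos_taylor (s h : R) :
  `|sqr_pos (h + s) - sqr_pos s - 2 * Num.max 0 s * h| <= h ^+ 2.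
Proof.
rewrite /sqr_pos ler_norml.
by case: (max0_cases (h + s)) => -[? ->]; case: (max0_cases s) => -[? ->];
  apply/andP; split; nra.
Qed.

Lemma is_derive_sqr_pos (s : R) : is_derive s 1 sqr_pos (2 * Num.max 0 s).
Proof.
have H : (fun h : R => h^-1 *: ((sqr_pos \o shift s) (h *: 1) - sqr_pos s))
    @ 0^' --> 2 * Num.max 0 s.
  apply/cvgrPdist_lt => e e0; near=> h.
  have h0 : h != 0 by near: h; exact: nbhs_dnbhs_neq.
  have he : `|h| < e by near: h; exact: dnbhs0_lt.
  rewrite /= [h%:A]mulr1; apply: le_lt_trans he.
  have h0' : 0 < `|h| by rewrite normr_gt0.
  rewrite -(ler_pM2l h0') distrC -normrM.
  have -> : h * (h^-1 *: (sqr_pos (h + s) - sqr_pos s) - 2 * Num.max 0 s) =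
      sqr_pos (h + s) - sqr_pos s - 2 * Num.max 0 s * h.
    by rewrite mulrBr /GRing.scale/= mulVKf// [h * _]mulrC.
  apply: le_trans (sqr_pos_taylor s h) _.
  by rewrite -expr2 real_normK ?num_real.
apply: DeriveDef; first by apply/cvg_ex; eexists; exact: H.
exact/cvg_lim/H.
Unshelve. all: by end_near. Qed.

Lemma derive_sqr_pos_comp (V : normedModType R) (g : V -> R) x v :
  differentiable g x ->
  differentiable (sqr_pos \o g) x /\
  'D_v (sqr_pos \o g) x = 2 * Num.max 0 (g x) * 'D_v g x.
Proof.
move=> dg; have [db Db] := is_derive_sqr_pos (g x).
have {}db : differentiable sqr_pos (g x) by exact/derivable1_diffP.
have dc : differentiable (sqr_pos \o g) x by exact: differentiable_comp.
split => //; rewrite deriveE// diff_comp//= -(deriveE v dg).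
by rewrite diff1E// derive1E Db /GRing.scale/= mulrC.
Qed.

Lemma C1_sqr_pos_comp (V : normedModType R) (U : set V) (g : V -> R) :
  open U -> Ck 1 U g -> Ck 1 U (sqr_pos \o g).
Proof.
move=> oU [dg Dg]; split => [x Ux|v].
  by have [] := derive_sqr_pos_comp 0 (dg x Ux).
have E x : U x -> 2 * Num.max 0 (g x) * 'D_v g x = 'D_v (sqr_pos \o g) x.
  by move=> Ux; have [] := derive_sqr_pos_comp v (dg x Ux).
apply: (Ck_eq (k := 0) oU E) => x Ux.
have cg : {for x, continuous g} by exact/differentiable_continuous/dg.
apply: cvgM; last exact: Dg.
apply: cvgM; first exact: cvg_cst.
by apply: continuous_max => //; exact: cvg_cst.
Qed.

Context {n : nat}.
Implicit Types (x y c v : 'rV[R]_n).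

Definition bump_arg c (r : R) y : R := r ^+ 2 - \sum_a (y 0 a - c 0 a) ^+ 2.

(** For [0 < r], this is positive exactly on the open Euclidean ball of centre
    [c] and radius [r]; the norm of row vectors is the maximum norm, which does
    not give a differentiable function. *)
Definition ball_bump c (r : R) : 'rV[R]_n -> R := sqr_pos \o bump_arg c r.

Lemma Ck_coord k (U : set 'rV[R]_n) a : open U ->
  Ck k U (fun y : 'rV[R]_n => y 0 a).
Proof.
move=> oU; apply: (Ck_entry (M := id)) => //.
by apply: (@Ck_lin _ _ _ k U idfun) => x; exact: cvg_id.
Qed.

Lemma derive_coord y v a : 'D_v (fun y : 'rV[R]_n => y 0 a) y = v 0 a.
Proof. by rewrite (derive_entry v 0 a (M := id))// derive_id. Qed.

Lemma bump_argE c r : bump_arg c r = fun y =>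
  r ^+ 2 - \sum_a ((y 0 a - c 0 a) * (y 0 a - c 0 a)).
Proof. by apply/funext => y. Qed.

Lemma Ck_bump_arg k (U : set 'rV[R]_n) c r : open U -> Ck k U (bump_arg c r).
Proof.
move=> oU; rewrite bump_argE.
have Ca a := CkB oU (Ck_coord k a oU) (@Ck_cst _ _ R k U (c 0 a)).
have Cs := Ck_sum (index_enum 'I_n) (P := xpredT) oU
  (fun a _ => CkM oU (Ca a) (Ca a)).
exact: (CkB oU (@Ck_cst _ _ R k U (r ^+ 2)) Cs).
Qed.

Lemma derive_bump_arg c r y v :
  'D_v (bump_arg c r) y = - \sum_a 2 * (y 0 a - c 0 a) * v 0 a.
Proof.
have dc a : is_derive y v (fun y : 'rV[R]_n => y 0 a - c 0 a) (v 0 a).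
  have d1 : is_derive y v (fun y : 'rV[R]_n => y 0 a) (v 0 a).
    apply: DeriveDef; last exact: derive_coord.
    exact/diff_derivable/differentiable_coord.
  have := is_deriveB d1 (is_derive_cst (c 0 a) y v).
  by rewrite subr0.
rewrite bump_argE.
have ds : is_derive y v
    (fun y : 'rV[R]_n => \sum_a ((y 0 a - c 0 a) * (y 0 a - c 0 a)))
    (\sum_a 2 * (y 0 a - c 0 a) * v 0 a).
  apply: is_derive_bigsum => a.
  apply: (is_derive_eq (is_deriveM (dc a) (dc a))).
  by rewrite /GRing.scale/=; ring.
have [_ ->] := is_deriveB (is_derive_cst (r ^+ 2) y v) ds.
by rewrite sub0r.
Qed.

Lemma C1_ball_bump (U : set 'rV[R]_n) c r : open U -> Ck 1 U (ball_bump c r).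
Proof. by move=> oU; apply: C1_sqr_pos_comp => //; exact: Ck_bump_arg. Qed.

Lemma ball_bump_ge0 c r y : 0 <= ball_bump c r y. Proof. exact: sqr_ge0. Qed.

Lemma ball_bump_center c r : 0 < r -> ball_bump c r c = r ^+ 4.
Proof.
move=> r0; rewrite /ball_bump /= /sqr_pos /bump_arg big1 => [|a _]; last first.
  by rewrite subrr expr0n.
rewrite subr0 max_r ?sqr_ge0//; ring.
Qed.

Lemma bump_arg_gt0 c r y a : 0 < r -> 0 < bump_arg c r y ->
  `|y 0 a - c 0 a| < r.
Proof.
move=> r0; rewrite subr_gt0 => H.
rewrite -(ltr_pXn2r (n := 2))// ?nnegrE// ?ltW//.
rewrite real_normK ?num_real//; apply: le_lt_trans H.
by rewrite (bigD1 a)//= lerDl sumr_ge0// => b _; exact: sqr_ge0.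
Qed.

Lemma ball_bump_neq0 c r y : 0 < r -> ball_bump c r y != 0 -> `|y - c| < r.
Proof.
move=> r0 by0; apply: rV_norm_lt => // a; rewrite !mxE.
apply: bump_arg_gt0 => //; apply: contraNT by0; rewrite -leNgt => H.
by rewrite /ball_bump /= /sqr_pos max_l// expr0n.
Qed.

(** Where the derivative is not zero, the factor coming from [sqr_pos] is at
    most [2 * r ^+ 2], and each of the [n] terms coming from the sum of squares
    is at most [2 * r * `|v|]. *)
Lemma derive_ball_bump c r y v : 0 < r ->
  `|'D_v (ball_bump c r) y| <= 4 * r ^+ 3 * n%:R * `|v|.
Proof.
move=> r0; have [da _] := Ck_bump_arg 1 c r (@openT 'rV[R]_n).
have [_ ->] := derive_sqr_pos_comp v (da y I).
rewrite derive_bump_arg.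
case: (max0_cases (bump_arg c r y)) => -[s0 ->]; last first.
  by rewrite mulr0 mul0r normr0 !mulr_ge0 ?exprn_ge0 ?(ltW r0).
have [->|sn0] := eqVneq (bump_arg c r y) 0.
  by rewrite mulr0 mul0r normr0 !mulr_ge0 ?exprn_ge0 ?(ltW r0).
have {}s0 : 0 < bump_arg c r y by rewrite lt_neqAle eq_sym sn0.
have sr : bump_arg c r y <= r ^+ 2.
  by rewrite gerDl oppr_le0 sumr_ge0// => a _; exact: sqr_ge0.
rewrite mulrN normrN normrM [`|2 * _|]gtr0_norm ?mulr_gt0//.
have H : `|\sum_a 2 * (y 0 a - c 0 a) * v 0 a| <= 2 * r * `|v| * n%:R.
  apply: le_trans (ler_norm_sum _ _ _) _.
  apply: (@le_trans _ _ (\sum_(a < n) 2 * r * `|v|)).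
    apply: ler_sum => a _; rewrite !normrM (gtr0_norm (_ : 0 < 2))//.
    rewrite -!mulrA ler_pM2l// ler_pM//; last exact: rV_entry_le.
    by rewrite ltW// bump_arg_gt0.
  by rewrite sumr_const card_ord -[_ *+ n]mulr_natr.
apply: (@le_trans _ _ (2 * r ^+ 2 * (2 * r * `|v| * n%:R))).
  by apply: ler_pM => //; [rewrite mulr_ge0// ltW|rewrite ler_pM2l].
rewrite le_eqVlt; apply/orP; left; apply/eqP; ring.
Qed.

Lemma derive_ball_bump_out c r y v : 0 < r ->
  r <= `|y - c| -> 'D_v (ball_bump c r) y = 0.
Proof.
move=> r0 ry; have [da _] := Ck_bump_arg 1 c r (@openT 'rV[R]_n).
have [_ ->] := derive_sqr_pos_comp v (da y I).
have : ball_bump c r y == 0.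
  by apply/negPn/negP => /(ball_bump_neq0 r0); rewrite ltNge ry.
rewrite /ball_bump /= /sqr_pos sqrf_eq0 => /eqP ->.
by rewrite mulr0 mul0r.
Qed.

End Bump.

(** * Limits of Jacobian equations in R^n *)

Section LowerBound.
Context {R : realType} {n : nat}.

(** The grid points in a small cube with corner [c] are a fixed fraction of all
    grid points, at least along the grids with [N.+1] a multiple of [2 * L]: on
    these, [c] is itself a grid point, and the indices from [L * K] to
    [L * K + K] give coordinates within [r / L] of those of [c]. *)
Lemma grid_sum_lower (c : 'rV[R]_n) (r d m : R) (g : 'rV[R]_n -> R) :
  0 < r -> 0 < d -> 0 < m -> (forall x, cube c r x -> 0 <= g x) ->
  (forall x, cube c r x -> `|x - c| < d -> m <= g x) ->
  exists2 k : R, 0 < k & forall N0, exists2 N, (N0 <= N)%N &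
    k * #|grid n N|%:R <= \sum_(z : grid n N) g (grid_pt c r z).
Proof.
move=> r0 d0 m0 g0 gm.
have [L L0 Ld] : exists2 L : nat, (0 < L)%N & r / L%:R < d.
  exists (Num.truncn (r / d)).+1 => //.
  rewrite ltr_pdivrMr// mulrC -ltr_pdivrMr//.
  exact: truncnS_gt.
exists (m / (2 * L)%:R ^+ n).
  by rewrite divr_gt0// exprn_gt0// ltr0n muln_gt0.
move=> N0; pose K := N0.+1.
have LK0 : (0 < L * K)%N by rewrite muln_gt0 L0.
pose N := (2 * L * K).-1.
have NE : N.+1 = (2 * L * K)%N by rewrite prednK// -mulnA muln_gt0.
exists N.
  by rewrite -ltnS NE (leq_trans (leqnn K))// leq_pmull// muln_gt0.
pose S : pred 'I_N.+1 := fun k => (L * K <= k < L * K + K)%N.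
have cardS : #|S| = K.
  have inS (w : 'I_K) : (L * K + w < N.+1)%N.
    rewrite NE -mulnA mul2n -addnn ltn_add2l (leq_trans (ltn_ord w))//.
    by rewrite leq_pmull.
  have injS : injective (fun w => Ordinal (inS w)).
    by move=> w w' /(congr1 val)/= /addnI /val_inj.
  rewrite -[RHS]card_ord -(fintype.card_image injS).
  apply: eq_card => k; apply/idP/mapP => [|[w _ ->]].
    rewrite unfold_in => /andP[k1 k2].
    have kK : (k - L * K < K)%N by rewrite ltn_subLR.
    exists (Ordinal kK); rewrite ?mem_enum//.
    by apply: val_inj; rewrite /= subnKC.
  by rewrite unfold_in /= leq_addr ltn_add2l ltn_ord.
pose Z : pred (grid n N) := [pred z | z \in ffun_on S].
apply: (@le_trans _ _ (\sum_(z in Z) m)); last first.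
  rewrite [leRHS](bigID (mem Z))/= -[leLHS]addr0 lerD//; last first.
    by apply: sumr_ge0 => z _; apply: g0; exact: grid_pt_in.
  apply: ler_sum => z Zz; apply: gm; first exact: grid_pt_in.
  apply: le_lt_trans Ld; apply: rV_norm_le => [|a].
    by rewrite divr_ge0// ltW.
  rewrite !mxE; have /ffun_onP/(_ a) := Zz; rewrite unfold_in => /andP[z1 z2].
  have E : grid_step r N * (L * K)%:R = r :> R.
    have LKn : (L * K)%:R != 0 :> R by rewrite pnatr_eq0 -lt0n.
    by rewrite /grid_step NE -mulnA natrM -mulf_div divff// mul1r divfK.
  have E2 : grid_step r N * K%:R * L%:R = r :> R.
    by rewrite -mulrA -natrM mulnC.
  have E3 : r / L%:R = grid_step r N * K%:R.
    by rewrite -{1}E2 mulfK// pnatr_eq0 -lt0n.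
  have s0 := grid_step_gt0 N r0.
  rewrite E3 ger0_norm.
    have : grid_step r N * (z a)%:R <= grid_step r N * (L * K + K)%:R :> R.
      by rewrite ler_pM2l// ler_nat ltnW.
    by rewrite natrD mulrDr E; lra.
  have : grid_step r N * (L * K)%:R <= grid_step r N * (z a)%:R :> R.
    by rewrite ler_pM2l// ler_nat.
  by rewrite E; lra.
rewrite sumr_const -[_ *+ #|_|]mulr_natr -mulrA ler_pM2l//.
have -> : #|Z| = (K ^ n)%N.
  transitivity (#|S| ^ #|'I_n|)%N; last by rewrite cardS card_ord.
  by rewrite -card_ffun_on; apply: eq_card.
have -> : #|grid n N| = (N.+1 ^ n)%N by rewrite card_ffun !card_ord.
rewrite NE expnMn [(_ * K ^ n)%:R]natrM !natrX mulKf// expf_neq0//.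
by rewrite pnatr_eq0 -lt0n muln_gt0.
Qed.

End LowerBound.

Section LocalTheorem.
Context {R : realType} {n : nat}.

(** The hypothesis before last, that [x] tends to [x0] when [F x] tends to
    [F x0], keeps the support of [beta o F] inside the cube on which [D] has a
    constant sign. *)
Theorem jacobian_limit (U B : set 'rV[R]_n) (F : 'rV[R]_n -> 'rV[R]_n)
    (rho rho' : 'rV[R]_n -> R) (x0 : 'rV[R]_n) :
  open U -> U x0 -> Ck 2 U F -> {for x0, continuous rho} ->
  open B -> B (F x0) -> Ck 1 B rho' ->
  (forall r, 0 < r -> exists2 eta, 0 < eta &
     forall x, U x -> `|F x - F x0| < eta -> `|x - x0| < r) ->
  (exists2 r0, 0 < r0 & forall e, 0 < e -> exists G U',
     [/\ open U', Ck 2 U' G & forall x, `|x - x0| <= r0 ->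
         [/\ U' x, `|G x - F x| < e & rho' (G x) * \det ('J G x) = rho x]]) ->
  rho' (F x0) * \det ('J F x0) = rho x0.
Proof.
move=> oU Ux0 CF crho oB Bx0 Crho' Finv [r0 r00 FG].
pose D x := rho x - rho' (F x) * \det ('J F x).
suff : D x0 = 0 by move/eqP; rewrite subr_eq0 eq_sym => /eqP.
apply/eqP; apply/negPn/negP => Dx0.
have cF x : U x -> {for x, continuous F} by exact: Ck_continuous CF x.
have cJ : {for x0, continuous (fun x => \det ('J F x))}.
  exact: Ck_continuous (Ck_det_jacobian oU CF) x0 Ux0.
have cD : {for x0, continuous D}.
  have crF : {for x0, continuous (fun x => rho' (F x))}.
    apply: (@continuous_comp _ _ _ F rho'); first exact: cF.
    exact: Ck_continuous Crho' _ Bx0.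
  exact: cvgB crho (cvgM crF cJ).
pose s := Num.sg (D x0); pose c := `|D x0| / 2.
have c0 : 0 < c by rewrite divr_gt0// normr_gt0.
have sc : s * D x0 = 2 * c by rewrite /s /c -normrEsg; field.
have s1 y : `|s * y| <= `|y|.
  rewrite normrM /s normr_sg; case: eqP => _; rewrite ?mul0r ?mul1r//.
have DE x : D x = rho x - rho' (F x) * \det ('J F x) by [].
clearbody s c D.
have weight b y : 0 <= b -> c <= s * y -> c * b <= s * (b * y).
  by move=> b0 cy; rewrite mulrCA mulrC ler_wpM2l.
have [d d0 dB] := open_dist oB Bx0.
have d20 : 0 < d / 2 by rewrite divr_gt0.
(* a cube on which [D] has a constant sign and stays away from zero *)
have [r r_gt0 rP] : exists2 r, 0 < r & forall x, `|x - x0| <= r ->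
    [/\ `|x - x0| <= r0, U x, c <= s * D x, `|rho x| <= `|rho x0| + 1 &
        `|F x - F x0| < d / 2].
  have [d1 d10 P1] := open_dist oU Ux0.
  have [d2 d20' P2] := continuous_dist cD c0.
  have [d3 d30 P3] := continuous_dist crho ltr01.
  have /cvgrPdist_lt/(_ _ d20)/nbhs_ballP[d4 /= d40 P4] := cF x0 Ux0.
  pose r := Num.min r0 (Num.min d1 (Num.min d2 (Num.min d3 d4))) / 2.
  have m0 : 0 < Num.min r0 (Num.min d1 (Num.min d2 (Num.min d3 d4))).
    by rewrite !lt_min r00 d10 d20' d30.
  exists r; first by rewrite divr_gt0.
  move=> x xr.
  have : `|x0 - x| < Num.min r0 (Num.min d1 (Num.min d2 (Num.min d3 d4))).
    by rewrite distrC (le_lt_trans xr)// /r; lra.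
  rewrite !lt_min => /and5P[x1 x2 x3 x4 x5]; split.
  - by rewrite distrC ltW.
  - exact: P1.
  - have : s * (D x0 - D x) <= c.
      apply: le_trans (ltW (P2 _ x3)); apply: le_trans (ler_norm _) _.
      exact: s1.
    by rewrite mulrBr sc lerBlDr mulr_natl mulr2n lerD2l.
  - have := P3 _ x4; rewrite distrC => H; rewrite -(subrK (rho x0) (rho x)).
    by apply: le_trans (ler_normD _ _) _; rewrite [leLHS]addrC lerD2l ltW.
  - by rewrite distrC; apply: P4; rewrite -ball_normE.
have [eta eta0 etaP] := Finv r r_gt0.
pose eta1 := eta / 2.
have eta10 : 0 < eta1 by rewrite divr_gt0.
pose beta := ball_bump (F x0) eta1.
pose f y := beta y * rho' y.
have Cf : Ck 1 B f := CkM oB (C1_ball_bump (F x0) eta1 oB) Crho'.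
have cube_r x : cube x0 r x <-> `|x - x0| <= r by apply: cube_norm; exact: ltW.
have cbeta y : {for y, continuous beta}.
  exact: Ck_continuous (C1_ball_bump (F x0) eta1 openT) y I.
have [k k0 kP] : exists2 k : R, 0 < k & forall N0, exists2 N, (N0 <= N)%N &
    k * #|grid n N|%:R <= \sum_(z : grid n N) beta (F (grid_pt x0 r z)).
  have m0 : 0 < eta1 ^+ 4 / 2 by rewrite divr_gt0// exprn_gt0.
  have cbF : {for x0, continuous (beta \o F)}.
    by apply: continuous_comp; [exact: cF|exact: cbeta].
  have [d' d'0 d'P] := continuous_dist cbF m0.
  apply: (grid_sum_lower (g := beta \o F) r_gt0 d'0 m0).
    by move=> x _; exact: ball_bump_ge0.
  move=> x _ xd; have := d'P x; rewrite distrC => /(_ xd) /=.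
  rewrite /beta ball_bump_center// ltr_distl => /andP[_]; lra.
pose q := c * k; have q0 : 0 < q by rewrite mulr_gt0.
pose m := `|rho x0| + 1; have m0 : 0 < m by rewrite ltr_wpDl.
have q40 : 0 < q / 4 by rewrite divr_gt0.
have q4m : 0 < q / 4 / m by rewrite divr_gt0.
have [d' d'0 d'P] := compact_unif_continuous (cube_compact (c := F x0) (r := d))
  (fun y _ => cbeta y) q4m.
pose e := Num.min eta1 (Num.min (d / 2) d').
have e0 : 0 < e by rewrite !lt_min eta10 d20.
have [G [U' [oU' CG GP]]] := FG e e0.
have GF x : `|x - x0| <= r -> [/\ U' x, `|G x - F x| < eta1,
    `|G x - F x| < d / 2, `|G x - F x| < d' &
    rho' (G x) * \det ('J G x) = rho x].
  move=> /rP[xr0 _ _ _ _]; have [Ux + E] := GP x xr0.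
  by rewrite !lt_min => /and3P[].
have segF t x : 0 <= t <= 1 -> `|segment_map F G t x - F x| <= `|G x - F x|.
  move=> /andP[t0 t1]; rewrite /segment_map addrC addKr normrZ ger0_norm//.
  exact: ler_piMl.
have oUU : open (U `&` U') by exact: openI.
have CFU := Ck_sub (@subIsetl _ U U') CF.
have CGU := Ck_sub (@subIsetr _ U U') CG.
have cU : cube x0 r `<=` U `&` U'.
  by move=> x /cube_r xr; split; [have [] := rP x xr|have [] := GF x xr].
have cB t x : 0 <= t <= 1 -> cube x0 r x -> B (segment_map F G t x).
  move=> t01 /cube_r xr; apply: dB.
  have [_ _ _ _ H1] := rP x xr; have [_ _ H2 _ _] := GF x xr.
  rewrite distrC -(subrKA (F x)) (splitr d).
  apply: le_lt_trans (ler_normD _ _) _; apply: ltrD => //.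
  exact: le_lt_trans (segF t x t01) H2.
(* on the boundary of the cube, [F x] is at distance at least [eta] of [F x0],
   and the segment from [F x] to [G x] has length less than [eta / 2] *)
have cf t x i : 0 <= t <= 1 -> cube x0 r x -> `|x 0 i - x0 0 i| = r ->
    f (segment_map F G t x) = 0.
  move=> t01 /cube_r xr xi; rewrite /f; apply/eqP; rewrite mulf_eq0.
  apply/orP; left; apply: contraTT isT => /(ball_bump_neq0 eta10) H1.
  have [_ Ux _ _ _] := rP x xr; have [_ H2 _ _ _] := GF x xr.
  have : `|F x - F x0| < eta.
    rewrite -(subrKA (segment_map F G t x)) (splitr eta).
    apply: le_lt_trans (ler_normD _ _) _; apply: ltrD => //.
    by rewrite distrC; exact: le_lt_trans (segF t x t01) H2.
  move=> /(etaP x Ux); rewrite -xi; have := rV_entry_le (x - x0) i.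
  by rewrite !mxE leNgt => /negP.
have [N0 _ N0P] := homotopy_grid_sum oUU CFU CGU oB Cf r_gt0 cU cB cf q40.
have [N N0N Nk] := kP N0; have {N0P} := N0P N N0N.
set S2 := \sum_z _ => S2P.
have gz (z : grid n N) : `|grid_pt x0 r z - x0| <= r.
  by apply/cube_r; exact: grid_pt_in.
have grid0 : 0 < #|grid n N|%:R :> R.
  by rewrite card_ffun !card_ord ltr0n expn_gt0.
(* [S1] is small because [beta] is uniformly continuous, [S2] by homotopy; their
   sum is the grid sum of [(beta o F) * D] *)
pose S1 := \sum_(z : grid n N) (beta (F (grid_pt x0 r z)) -
  beta (G (grid_pt x0 r z))) * rho (grid_pt x0 r z).
have S1P : `|S1| <= q / 4 * #|grid n N|%:R.
  apply: le_trans (ler_norm_sum _ _ _) _.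
  apply: (@le_trans _ _ (\sum_(z : grid n N) q / 4)); last first.
    by rewrite sumr_const -[_ *+ #|_|]mulr_natr.
  apply: ler_sum => z _; rewrite normrM.
  have [_ _ _ H1 H3] := rP _ (gz z); have [_ _ H2 H4 _] := GF _ (gz z).
  have -> : q / 4 = q / 4 / m * m by rewrite divfK// gt_eqF.
  apply: ler_pM => //; rewrite ltW// distrC; apply: d'P => //.
    apply/cube_norm; first exact: ltW.
    rewrite -(subrKA (F (grid_pt x0 r z))).
    apply: le_trans (ler_normD _ _) _; rewrite (splitr d).
    by apply: lerD; exact: ltW.
  by apply/cube_norm; [exact: ltW|]; apply: le_trans (ltW H3) _; lra.
have E : \sum_(z : grid n N) beta (F (grid_pt x0 r z)) * D (grid_pt x0 r z) =
    S1 + S2.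
  rewrite -big_split/=; apply: eq_bigr => z _.
  have [_ _ _ _ H] := GF _ (gz z).
  rewrite /f -mulrA H DE; ring.
have : q * #|grid n N|%:R <= s * (S1 + S2).
  rewrite -E mulr_sumr; apply: (@le_trans _ _
    (\sum_(z : grid n N) c * beta (F (grid_pt x0 r z)))).
    by rewrite -mulr_sumr /q -mulrA ler_pM2l.
  apply: ler_sum => z _; apply: weight; first exact: ball_bump_ge0.
  by have [] := rP _ (gz z).
apply/negP; rewrite -ltNge.
apply: (@le_lt_trans _ _ (q / 4 * #|grid n N|%:R + q / 4 * #|grid n N|%:R)).
  apply: le_trans (ler_norm _) _; apply: le_trans (s1 _) _.
  by apply: le_trans (ler_normD _ _) _; exact: lerD.
by rewrite -mulrDl ltr_pM2r//; lra.
Qed.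

End LocalTheorem.

(** * Alternating forms of top degree *)

Section AlternatingForms.
Context {R : realType} {n : nat}.
Implicit Types (A : 'M[R]_n) (v w : 'rV[R]_n) (g : 'M[R]_n -> R).

Definition set_row (k : 'I_n) v A : 'M[R]_n :=
  \matrix_(i, j) if i == k then v 0 j else A i j.

Lemma row_set_row k v A : row k (set_row k v A) = v.
Proof. by apply/rowP => j; rewrite !mxE eqxx. Qed.

Lemma row_set_row_neq k l v A : k != l -> row k (set_row l v A) = row k A.
Proof. by move=> /negbTE kl; apply/rowP => j; rewrite !mxE kl. Qed.

Lemma row'_set_row k v A : row' k (set_row k v A) = row' k A.
Proof.
by apply/matrixP => i j; rewrite !mxE eq_sym (negbTE (neq_lift _ _)).
Qed.

Lemma set_row_id k A : set_row k (row k A) A = A.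
Proof. by apply/matrixP => i j; rewrite !mxE; case: eqP => // ->. Qed.

Lemma set_rowC k l v w A : k != l ->
  set_row k v (set_row l w A) = set_row l w (set_row k v A).
Proof.
move=> kl; apply/matrixP => i j; rewrite !mxE.
by have [->|//] := eqVneq i k; rewrite (negbTE kl).
Qed.

Variable g : 'M[R]_n -> R.
Hypothesis g_alt : alternating_form g.

Lemma alternating_lin k A b c v w :
  g (set_row k (b *: v + c *: w) A) =
  b * g (set_row k v A) + c * g (set_row k w A).
Proof.
have [lin _] := g_alt.
by apply: (lin k); rewrite ?row_set_row ?row'_set_row.
Qed.

Lemma alternating_add k A v w :
  g (set_row k (v + w) A) = g (set_row k v A) + g (set_row k w A).
Proof.
by rewrite -[v in LHS]scale1r -[w in LHS]scale1r alternating_lin !mul1r.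
Qed.

Lemma alternating_swap k l A : k != l -> g (xrow k l A) = - g A.
Proof.
move=> kl; have [_ alt] := g_alt.
pose M v w := set_row k v (set_row l w A).
have E : g (M (row k A + row l A) (row k A + row l A)) = 0.
  apply: (alt _ k l) => //.
  by rewrite row_set_row row_set_row_neq 1?eq_sym// row_set_row.
have Z v : g (M v v) = 0.
  apply: (alt _ k l) => //.
  by rewrite row_set_row row_set_row_neq 1?eq_sym// row_set_row.
have E1 : M (row k A) (row l A) = A by rewrite /M set_row_id set_row_id.
have E2 : M (row l A) (row k A) = xrow k l A.
  apply/matrixP => i j; rewrite !mxE.
  have [->|ik] := eqVneq i k; first by rewrite tpermL.
  have [->|il] := eqVneq i l; first by rewrite tpermR.
  by rewrite tpermD// eq_sym.
have addl v w x : g (M (v + w) x) = g (M v x) + g (M w x).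
  exact: alternating_add.
have addr x v w : g (M x (v + w)) = g (M x v) + g (M x w).
  by rewrite /M !(set_rowC _ _ _ kl) alternating_add.
move: E; rewrite addl !addr !Z E1 E2 add0r addr0 => /eqP.
by rewrite addrC addr_eq0 => /eqP.
Qed.

Lemma alternating_sum k A (I : Type) (r : seq I) (c : I -> R)
    (v : I -> 'rV[R]_n) :
  g (set_row k (\sum_(i <- r) c i *: v i) A) =
  \sum_(i <- r) c i * g (set_row k (v i) A).
Proof.
elim: r => [|i r IH].
  rewrite !big_nil.
  rewrite -[0 in LHS]addr0 -[0 in LHS](scale0r (0 : 'rV[R]_n)).
  by rewrite alternating_lin !mul0r addr0.
by rewrite !big_cons -[X in _ + X]scale1r alternating_lin IH mul1r.
Qed.

(** Expanding the rows one after the other reduces the claim to matrices whose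
    rows are unit vectors: either two rows agree, or the matrix is that of a
    permutation, a product of transpositions. *)
Lemma alternating_eq0 A : g 1%:M = 0 -> g A = 0.
Proof.
move=> g1; have [_ alt] := g_alt.
have gperm (s : 'S_n) : g (perm_mx s) = 0.
  have [ts -> dts] := prod_tpermP s; elim: ts dts => [|[k l] ts IH] /=.
    by rewrite big_nil perm_mx1.
  move=> /andP[kl dts]; rewrite big_cons perm_mxM -/(tperm_mx k l).
  by rewrite -xrowE alternating_swap// IH// oppr0.
suff H m B :
    (forall i : 'I_n, (m <= i)%N -> exists j, row i B = delta_mx 0 j) ->
    g B = 0 by apply: (H n) => i; rewrite leqNgt ltn_ord.
elim: m B => [|m IH] B HB.
  have /choice[s sP] : forall i, exists j, row i B = delta_mx 0 j.
    by move=> i; exact: HB.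
  have [/injectiveP inj_s|/injectivePn[k [l kl skl]]] := boolP (injectiveb s).
    rewrite (_ : B = perm_mx (perm inj_s)) ?gperm//.
    apply/row_matrixP => i; rewrite sP; apply/rowP => j.
    by rewrite !mxE permE eqxx eq_sym.
  by apply: (alt _ k l) => //; rewrite !sP skl.
have [mn|nm] := ltnP m n; last first.
  by apply: IH => i mi; have := ltn_ord i; rewrite ltnNge (leq_trans nm mi).
pose k := Ordinal mn.
rewrite -(set_row_id k B) (row_sum_delta (row k B)) alternating_sum.
rewrite big1// => j _; rewrite IH ?mulr0// => i mi; have [->|ik] := eqVneq i k.
  by exists j; rewrite row_set_row.
rewrite row_set_row_neq//; apply: HB.
rewrite ltn_neqAle mi andbT eq_sym; apply: contra ik => /eqP im.
exact/eqP/val_inj.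
Qed.

End AlternatingForms.

Lemma alternating_form_det {R : realType} n (f : 'M[R]_n -> R) A :
  alternating_form f -> f A = \det A * f 1%:M.
Proof.
move=> [lin alt]; apply/eqP; rewrite -subr_eq0; apply/eqP.
apply: (@alternating_eq0 _ _ (fun A => f A - \det A * f 1%:M)); last first.
  by rewrite det1 mul1r subrr.
split => [k A1 B C b c E1 E2 E3|A1 k l kl E].
  rewrite (lin k _ B C b c)// (determinant_multilinear E1 E2 E3); ring.
rewrite (alt _ k l)// (determinant_alternate kl) ?mul0r ?subrr// => j.
by have /rowP/(_ j) := E; rewrite !mxE.
Qed.

(** * Volume-preserving maps in charts *)

Section Jacobians.
Context {R : realType}.

Lemma jacobian_comp m n p (f : 'rV[R]_m -> 'rV[R]_n) (g : 'rV[R]_n -> 'rV[R]_p)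
    x : differentiable f x -> differentiable g (f x) ->
  'J (g \o f) x = 'J f x *m 'J g (f x).
Proof.
move=> df dg; apply/row_matrixP => i; rewrite !rowE mulmxA.
by rewrite /jacobian !mul_rV_lin1 diff_comp.
Qed.

Lemma near_eq_jacobian m n (f g : 'rV[R]_m -> 'rV[R]_n) x :
  (\near x, f x = g x) -> differentiable f x -> 'J g x = 'J f x.
Proof.
move=> fg df; have [_ E] := near_eq_diff fg df.
apply/matrixP => i j; rewrite [LHS]mxE [RHS]mxE.
exact: (congr1 (fun h : 'rV[R]_m -> 'rV[R]_n => h (delta_mx 0 i) 0 j) E).
Qed.

End Jacobians.

Section Charts.
Context {R : realType} {n : nat} {T : topologicalType}.
Implicit Types (c : chart R n T) (O : set T).

Lemma open_chart_image c O : open O -> open (c @` (chart_dom c `&` O)).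
Proof.
move=> oO; rewrite openE => _ [p [cp Op] <-].
have cimg : (c @` chart_dom c) (c p) by exists p.
have H1 : \forall y \near c p, (c @` chart_dom c) y.
  by apply: open_nbhs_nbhs; split=> //; exact: chart_img_open.
have H2 : \forall y \near c p, O (chart_inv c y).
  apply: (chart_inv_continuous cimg); rewrite chart_mapK//.
  exact: open_nbhs_nbhs.
apply: filterS (filterI H1 H2) => _ [[q cq <-]].
by rewrite chart_mapK// => Oq; exists q.
Qed.

End Charts.

Section Manifold.
Context {R : realType} {n : nat} {M : smooth_manifold R n}.
Implicit Types (p : M) (i j k : chart_idx M) (phi : M -> M).

Definition rep_dom i j phi : set 'rV[R]_n :=
  atlas i @` (chart_dom (atlas i) `&` phi @^-1` chart_dom (atlas j)).

Lemma local_repE i j phi p : in_chart i p ->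
  local_rep i j phi (atlas i p) = atlas j (phi p).
Proof. by move=> ip; rewrite /local_rep /= chart_mapK. Qed.

Lemma rep_dom_in i j phi p : in_chart i p -> in_chart j (phi p) ->
  rep_dom i j phi (atlas i p).
Proof. by move=> ip jp; exists p. Qed.

Lemma rep_dom_open i j phi : continuous phi -> open (rep_dom i j phi).
Proof.
move=> cphi; apply: open_chart_image; apply: open_comp => [x _|].
  exact: cphi.
exact: chart_dom_open.
Qed.

Lemma local_rep_differentiable i j phi p : smooth_map phi ->
  in_chart i p -> in_chart j (phi p) ->
  differentiable (local_rep i j phi) (atlas i p).
Proof.
move=> [_ sphi] ip jp; have [dphi _] := sphi i j 1.
exact/dphi/rep_dom_in.
Qed.

Lemma change_differentiable i j p : in_chart i p -> in_chart j p ->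
  differentiable (local_rep i j id) (atlas i p).
Proof.
move=> ip jp; have [dphi _] := @atlas_smooth _ _ M i j 1.
apply: dphi; by exists p.
Qed.

Lemma jac_change i j k phi p : smooth_map phi ->
  in_chart i p -> in_chart j (phi p) -> in_chart k (phi p) ->
  jac i k phi p = jac i j phi p *m jac j k id (phi p).
Proof.
move=> sphi ip jp kp.
have d1 := local_rep_differentiable sphi ip jp.
have E := local_repE j phi ip.
have d2 : differentiable (local_rep j k id) (local_rep i j phi (atlas i p)).
  by rewrite E; exact: change_differentiable.
have J := jacobian_comp d1 d2.
rewrite E in J; rewrite /jac -J.
apply: near_eq_jacobian (differentiable_comp d1 d2).
have [cphi _] := sphi.
apply: (@open_near_eq _ _ _ (rep_dom i j phi)).
- exact: rep_dom_open.
- exact: rep_dom_in.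
- by move=> _ [q [iq jq] <-]; rewrite /= !local_repE.
Qed.

(** The coefficient of the form with respect to the volume form of the
    coordinates. *)
Definition density (Omega : top_form M) i p : R := Omega i p 1%:M.

Lemma density_smooth (Omega : top_form M) i :
  Cinfty (chart_img (atlas i))
    (density Omega i \o chart_inv (atlas i) : _ -> R).
Proof. exact: form_smooth. Qed.

Lemma pullback_density (Omega : top_form M) phi i j p A : smooth_map phi ->
  in_chart i p -> in_chart j (phi p) ->
  pullback phi Omega i p A =
  \det A * (density Omega j (phi p) * \det (jac i j phi p)).
Proof.
move=> sphi ip jp; rewrite /pullback; set k := chart_at _.
have kp : in_chart k (phi p) by exact: chart_at_dom.
rewrite (form_compat Omega _ kp jp) -mulmxA -jac_change//.
rewrite (alternating_form_det _ (form_alternating Omega jp)).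
by rewrite det_mulmx -mulrA [\det (jac _ _ _ _) * _]mulrC.
Qed.

(** Both sides of the equation defining preservation are alternating forms, so
    they agree as soon as they agree on the coordinate frame. *)
Lemma Diff_volP (Omega : top_form M) phi : Diff M phi ->
  Diff_vol Omega phi <->
  forall i j p, in_chart i p -> in_chart j (phi p) ->
    density Omega j (phi p) * \det (jac i j phi p) = density Omega i p.
Proof.
move=> Dphi; have [sphi _] := Dphi; split => [[_ vol] i j p ip jp|vol].
  have := vol i p 1%:M ip; rewrite (pullback_density _ _ sphi ip jp).
  by rewrite det1 mul1r.
split => // i p A ip.
have jp : in_chart (chart_at (phi p)) (phi p) by exact: chart_at_dom.
rewrite (pullback_density _ _ sphi ip jp) vol//.
by rewrite -(alternating_form_det _ (form_alternating Omega ip)).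
Qed.

End Manifold.

(** * Lengths of curves *)

(** Integrating from [-1] makes [0] an interior point, where the primitive is
    differentiable on both sides. *)
Lemma continuous_primitive {R : realType} (s : R -> R) : continuous s ->
  exists2 P : R -> R, (forall t : R, 0 <= t <= 1 -> is_derive t 1 P (s t)) &
    \int[lebesgue_measure]_(t in `[0, 1]) s t = P 1 - P 0.
Proof.
move=> cs; pose P x := \int[lebesgue_measure]_(t in `[-1, x]) s t.
have ints (a b : R) : lebesgue_measure.-integrable `[a, b] (EFin \o s).
  apply: continuous_compact_integrable; first exact: segment_compact.
  exact: continuous_subspaceT.
have dP (t : R) : 0 <= t <= 1 -> is_derive t 1 P (s t).
  move=> /andP[t0 t1].
  have t2 : t < 2 by lra.
  have tN1 : -1 < t by lra.
  have [d E] := continuous_FTC1_closed t2 (ints _ _) tN1 (cs t).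
  by apply: DeriveDef; [exact: d|rewrite -derive1E].
exists P => //.
have cP (t : R) : 0 <= t <= 1 -> {for t, continuous P}.
  move=> /dP[d _]; apply: differentiable_continuous.
  exact/derivable1_diffP.
rewrite /Rintegral (@continuous_FTC2 _ s P)//.
- exact: continuous_subspaceT.
- split.
  + move=> t; rewrite in_itv/= => /andP[? ?].
    by have [] := dP t _; rewrite ?ltW.
  + by apply: cvg_at_right_filter; apply: cP; rewrite lexx ler01.
  + by apply: cvg_at_left_filter; apply: cP; rewrite lexx ler01.
- move=> t; rewrite in_itv/= => /andP[? ?]; rewrite derive1E.
  by have [] := dP t _; rewrite ?ltW.
Qed.

(** Comparing [h] with a multiple of a primitive of [s] requires no continuity
    of the derivative of [h]. *)
Lemma variation_le_integral {R : realType} (h s : R -> R) (L : R) :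
  continuous s -> (forall t, derivable h t 1) ->
  (forall t, `|'D_1 h t| <= L * s t) ->
  `|h 1 - h 0| <= L * \int[lebesgue_measure]_(t in `[0, 1]) s t.
Proof.
move=> cs dh hs; have [P dP ->] := continuous_primitive cs.
have key (k : R -> R) : (forall t, derivable k t 1) ->
    (forall t, `|'D_1 k t| <= L * s t) -> k 1 - k 0 <= L * (P 1 - P 0).
  move=> dk ks; pose f t := k t - L * P t.
  pose df t := 'D_1 k t - L * s t.
  have df_ (t : R) : 0 <= t <= 1 -> is_derive t 1 f (df t).
    move=> t01; apply: (@is_deriveB _ _ _ k (fun t => L * P t)).
      exact/derivableP.
    by have dPt := dP t t01; exact: is_deriveZ.
  have [||t _] := @MVT R f df 0 1 ltr01.
  - by move=> t; rewrite in_itv/= => /andP[? ?]; apply: df_; rewrite !ltW.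
  - apply: derivable_within_continuous => t; rewrite in_itv/= => t01.
    by have [] := df_ t t01.
  - have : 'D_1 k t <= L * s t by exact: le_trans (ler_norm _) (ks t).
    by rewrite /f /df subr0 mulr1 mulrBr; lra.
rewrite ler_norml; apply/andP; split; last exact: key.
have : - h 1 - - h 0 <= L * (P 1 - P 0).
  apply: (key (fun t => - h t)) => t; first exact: derivableN.
  by rewrite deriveN// normrN.
by lra.
Qed.

Section Curves.
Context {R : realType} {n : nat} {M : smooth_manifold R n}.
Variable g : riemannian_metric M.
Implicit Types (p : M) (i j : chart_idx M) (sigma : R -> M) (v : 'rV[R]_n).

Definition metric_sq i p v : R := (v *m g i p *m v^T) 0 0.

Lemma metric_sqE i p v :
  metric_sq i p v = \sum_b \sum_a v 0 a * g i p a b * v 0 b.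
Proof.
rewrite /metric_sq mxE; apply: eq_bigr => b _; rewrite !mxE mulr_suml.
by apply: eq_bigr.
Qed.

Definition velocity i sigma t : 'rV[R]_n := derive1 (atlas i \o sigma) t.

Lemma curve_near sigma t (A : set M) : continuous sigma -> open A ->
  A (sigma t) -> \forall s \near t, A (sigma s).
Proof. by move=> cs oA At; apply: cs; exact: open_nbhs_nbhs. Qed.

Lemma curve_differentiable i sigma t : smooth_curve sigma ->
  in_chart i (sigma t) -> differentiable (atlas i \o sigma) t.
Proof. by move=> [_ ss] it; have [ds _] := ss i 1; exact: ds. Qed.

Lemma velocity_change i j sigma t : smooth_curve sigma ->
  in_chart i (sigma t) -> in_chart j (sigma t) ->
  velocity j sigma t = velocity i sigma t *m jac i j id (sigma t).
Proof.
move=> ss it jt; have di := curve_differentiable ss it.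
have dj := curve_differentiable ss jt.
have dij := change_differentiable it jt.
rewrite /velocity !derive1E' // /jac /jacobian mul_rV_lin1.
have nE : \near t, (local_rep i j id \o (atlas i \o sigma)) t =
    (atlas j \o sigma) t.
  have [cs _] := ss.
  have := curve_near cs (@chart_dom_open _ _ _ (atlas i)) it.
  by apply: filterS => s is_; rewrite /= local_repE.
have dc : differentiable (local_rep i j id \o (atlas i \o sigma)) t.
  exact: differentiable_comp.
have [_ E] := near_eq_diff nE dc.
exact: etrans (congr1 (fun h : R -> 'rV[R]_n => h 1) E)
  (congr1 (fun h : R -> 'rV[R]_n => h 1) (diff_comp di dij)).
Qed.

Lemma speedE i sigma t : smooth_curve sigma -> in_chart i (sigma t) ->
  speed g sigma t = Num.sqrt (metric_sq i (sigma t) (velocity i sigma t)).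
Proof.
move=> ss it; set j := chart_at (sigma t).
have jt : in_chart j (sigma t) by exact: chart_at_dom.
rewrite /speed -/j -/(velocity j sigma t); congr Num.sqrt.
rewrite (velocity_change ss jt it) /metric_sq (metric_compat g jt it).
by rewrite trmx_mul !mulmxA.
Qed.

Lemma metric_entry_continuous i (y : 'rV[R]_n) a b : chart_img (atlas i) y ->
  {for y, continuous (fun x => g i (chart_inv (atlas i) x) a b)}.
Proof.
move=> iy; apply: (@continuous_comp _ _ _
  (fun x => g i (chart_inv (atlas i) x)) (fun N : 'M[R]_n => N a b)).
  exact: (metric_smooth g i 0).
exact: coord_continuous.
Qed.

(** Since [chart_at] is an arbitrary choice of charts, continuity is seen in a
    fixed chart, by [speedE]. It makes the speed integrable, so that
    [curve_length] is a genuine integral. *)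
Lemma speed_continuous sigma : smooth_curve sigma -> continuous (speed g sigma).
Proof.
move=> ss t; have [cs Cs] := ss; set i := chart_at (sigma t).
have it : in_chart i (sigma t) by exact: chart_at_dom.
have near_i := curve_near cs (@chart_dom_open _ _ _ (atlas i)) it.
pose G s := \sum_b \sum_a velocity i sigma s 0 a *
  g i (chart_inv (atlas i) (atlas i (sigma s))) a b * velocity i sigma s 0 b.
have GE : \forall s \near t, Num.sqrt (G s) = speed g sigma s.
  apply: filterS near_i => s is_; rewrite (speedE ss is_) metric_sqE /G.
  by rewrite chart_mapK.
have cv a : {for t, continuous (fun s => velocity i sigma s 0 a)}.
  apply: (@continuous_comp _ _ _ (velocity i sigma)
    (fun v : 'rV[R]_n => v 0 a)).
    have -> : velocity i sigma = 'D_1 (atlas i \o sigma).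
      by apply/funext => s; rewrite /velocity derive1E.
    by have [_ DC] := Cs i 1; exact: DC.
  exact: coord_continuous.
have ca : {for t, continuous (atlas i \o sigma)}.
  exact/differentiable_continuous/curve_differentiable.
have cg a b : {for t, continuous
    (fun s => g i (chart_inv (atlas i) (atlas i (sigma s))) a b)}.
  apply: (@continuous_comp _ _ _ (atlas i \o sigma)
    (fun x => g i (chart_inv (atlas i) x) a b)) => //.
  by apply: metric_entry_continuous; exists (sigma t).
have cG : {for t, continuous G}.
  apply: continuous_bigsum => b; apply: continuous_bigsum => a.
  exact: cvgM (cvgM (cv a) (cg a b)) (cv b).
have cG' : {for t, continuous (fun s => Num.sqrt (G s))}.
  by apply: continuous_comp cG _; exact: sqrt_continuous.
rewrite /continuous_at -(nbhs_singleton GE).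
by apply: cvg_trans cG'; apply: near_eq_cvg; apply: filterS GE => s.
Qed.

Lemma curve_length_ge0 sigma : 0 <= curve_length g sigma.
Proof. by apply: Rintegral_ge0 => t _; exact: sqrtr_ge0. Qed.

End Curves.

(** * The Riemannian distance controls the charts *)

Section Comparison.
Context {R : realType} {n : nat} {M : smooth_manifold R n}.
Variable g : riemannian_metric M.
Implicit Types (p q : M) (i j : chart_idx M) (sigma : R -> M) (v y : 'rV[R]_n).

Let G i y : 'M[R]_n := g i (chart_inv (atlas i) y).

Let Q (N : 'M[R]_n) v : R := \sum_b \sum_a v 0 a * N a b * v 0 b.

Let QZ N (t : R) v : Q N (t *: v) = t ^+ 2 * Q N v.
Proof.
rewrite /Q mulr_sumr; apply: eq_bigr => b _; rewrite mulr_sumr.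
apply: eq_bigr => a _; rewrite !mxE; ring.
Qed.

Let Q_dist N N' v : `|v| = 1 ->
  `|Q N v - Q N' v| <= \sum_b \sum_a `|N a b - N' a b|.
Proof.
move=> v1; rewrite /Q -sumrB; apply: le_trans (ler_norm_sum _ _ _) _.
apply: ler_sum => b _; rewrite -sumrB; apply: le_trans (ler_norm_sum _ _ _) _.
apply: ler_sum => a _; rewrite -mulrBl -mulrBr !normrM.
have va := rV_entry_le v a; have vb := rV_entry_le v b.
rewrite v1 in va vb; rewrite -[leRHS]mulr1; apply: ler_pM => //.
by rewrite -[leRHS]mul1r; apply: ler_pM.
Qed.

Let Q_continuous N : continuous (Q N).
Proof.
move=> v; apply: continuous_bigsum => b; apply: continuous_bigsum => a.
have ca (c : 'I_n) : {for v, continuous (fun v : 'rV[R]_n => v 0 c)}.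
  exact: coord_continuous.
exact: cvgM (cvgM (ca a) (cvg_cst (N a b))) (ca b).
Qed.

Let sphere_min i y0 : chart_img (atlas i) y0 ->
  exists2 m : R, 0 < m & forall v, `|v| = 1 -> m <= Q (G i y0) v.
Proof.
move=> iy0; pose S := [set v : 'rV[R]_n | `|v| = 1].
have [S0|/set0P S0] := eqVneq S set0.
  by exists 1 => // v v1; exfalso; have : S v by []; rewrite S0.
have cS : compact S.
  apply: bounded_closed_compact.
    by exists 1; split => // x x1 v /= ->; exact: ltW.
  apply: (@closed_comp _ _ (fun v : 'rV[R]_n => `|v|) [set 1]).
    by move=> v _; exact: norm_continuous.
  exact: closed_eq.
have [w Sw wmin] := EVT_min_rV S0 cS
  (continuous_subspaceT (@Q_continuous (G i y0))).
rewrite inE /S /= in Sw.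
exists (Q (G i y0) w) => [|v v1]; last by apply: wmin; rewrite inE.
have [p ip py] := iy0.
have w0 : w != 0 by rewrite -normr_eq0 Sw oner_neq0.
have := metric_pos g ip w0; rewrite -/(metric_sq g i p w) metric_sqE.
by rewrite /Q /G -py chart_mapK.
Qed.

(** At [y0], the quadratic form is bounded below on the unit sphere, which is
    compact; half of this bound persists near [y0], because the coefficients of
    the metric are continuous. *)
Lemma norm_le_metric i y0 : chart_img (atlas i) y0 ->
  exists2 d : R, 0 < d & exists2 C : R, 0 < C & forall y, `|y0 - y| < d ->
    chart_img (atlas i) y /\
    forall v, `|v| <= C * Num.sqrt (metric_sq g i (chart_inv (atlas i) y) v).
Proof.
move=> iy0; have [m m0 mP] := sphere_min iy0.
have m2 : 0 < m / 2 by rewrite divr_gt0.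
pose D y := \sum_b \sum_a `|G i y a b - G i y0 a b|.
have cD : {for y0, continuous D}.
  apply: continuous_bigsum => b; apply: continuous_bigsum => a.
  apply: (@continuous_comp _ _ _ (fun y => G i y a b - G i y0 a b) Num.norm).
    have cG : {for y0, continuous (fun y => G i y a b)}.
      exact: metric_entry_continuous.
    exact: cvgB cG (cvg_cst (G i y0 a b)).
  exact: norm_continuous.
have [d1 d10 P1] := continuous_dist cD m2.
have [d2 d20 P2] := open_dist (@chart_img_open _ _ _ (atlas i)) iy0.
exists (Num.min d1 d2); first by rewrite lt_min d10.
exists (Num.sqrt (2 / m)); first by rewrite sqrtr_gt0 divr_gt0.
move=> y; rewrite lt_min => /andP[y1 y2]; split; first exact: P2.
have D0 : D y0 = 0.
  by rewrite /D big1// => b _; rewrite big1// => a _; rewrite subrr normr0.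
have QS v : `|v| = 1 -> m / 2 <= Q (G i y) v.
  move=> v1; have := P1 y y1.
  rewrite D0 sub0r normrN => /(le_lt_trans (ler_norm _)) Dy.
  have := Q_dist (G i y) (G i y0) v1; rewrite -/(D y) ler_norml => /andP[H _].
  have := mP v v1; lra.
move=> v; have [->|v0] := eqVneq v 0.
  by rewrite normr0 mulr_ge0// sqrtr_ge0.
have nv0 : 0 < `|v| by rewrite normr_gt0.
rewrite metric_sqE -/(G i y) -/(Q (G i y) v).
have E : Q (G i y) v = `|v| ^+ 2 * Q (G i y) (`|v|^-1 *: v).
  by rewrite QZ mulrA -exprMn divff ?gt_eqF// expr1n mul1r.
have H : `|v| ^+ 2 <= 2 / m * Q (G i y) v.
  rewrite E mulrCA -[leLHS]mulr1; apply: ler_wpM2l; first exact: sqr_ge0.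
  have := QS (`|v|^-1 *: v).
  rewrite normrZ normfV normr_id mulVf ?gt_eqF// => /(_ erefl) H.
  rewrite -[leLHS](_ : 2 / m * (m / 2) = 1); last by field; rewrite gt_eqF.
  by rewrite ler_pM2l// divr_gt0.
rewrite -sqrtrM; last by rewrite divr_ge0// ltW.
by rewrite -[leLHS]normr_id -sqrtr_sqr ler_wsqrtr.
Qed.

End Comparison.

Section ManifoldBump.
Context {R : realType} {n : nat} {M : smooth_manifold R n}.
Variables (g : riemannian_metric M) (i : chart_idx M).
Variables (c : 'rV[R]_n) (r C : R).
Hypotheses (r0 : 0 < r) (C0 : 0 < C).
Hypothesis img : forall y, `|y - c| <= r -> chart_img (atlas i) y.
Hypothesis dom : forall y v, `|y - c| < r ->
  `|v| <= C * Num.sqrt (metric_sq g i (chart_inv (atlas i) y) v).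

(** The bump function of the chart, extended by zero to the whole manifold. *)
Definition manifold_bump (p : M) : R :=
  if `[< in_chart i p >] then ball_bump c r (atlas i p) else 0.

Let bump_in p : in_chart i p -> manifold_bump p = ball_bump c r (atlas i p).
Proof. by move=> ip; rewrite /manifold_bump asboolT. Qed.

Let E : set M := [set p | in_chart i p /\ `|atlas i p - c| <= r].

(** A compact subset of the chart is closed in the manifold, by the Hausdorff
    property. Its complement is open, so the extension by zero is differentiable
    along curves leaving the chart. *)
Let E_closed : closed E.
Proof.
apply: compact_closed; first exact: manifold_hausdorff.
have -> : E = chart_inv (atlas i) @` cube c r.
  apply/seteqP; split => [p [ip pc]|_ [y /cube_norm-/(_ (ltW r0)) yc <-]].
    exists (atlas i p); last exact: chart_mapK.
    exact/cube_norm/pc/ltW.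
  by have [p ip py] := img yc; rewrite -py chart_mapK// /E /= py.
apply: continuous_compact; last exact: cube_compact.
apply: continuous_in_subspaceT => y; rewrite inE => /cube_norm-/(_ (ltW r0)) yc.
by apply: chart_inv_continuous; exact: img.
Qed.

Let bump_out p : ~ E p -> manifold_bump p = 0.
Proof.
rewrite /manifold_bump; case: asboolP => // ip Ep.
apply/eqP/negPn/negP => /(ball_bump_neq0 r0)/ltW pc; exact: Ep.
Qed.

(** The summand [1] only makes the constant positive in dimension 0. *)
Let L : R := 4 * r ^+ 3 * n%:R * C + 1.

Let L0 : 0 < L.
Proof. by rewrite ltr_wpDl// !mulr_ge0 ?exprn_ge0 ?(ltW r0) ?(ltW C0). Qed.

Let bump_curve (sigma : R -> M) t : smooth_curve sigma ->
  derivable (manifold_bump \o sigma) t 1 /\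
  `|'D_1 (manifold_bump \o sigma) t| <= L * speed g sigma t.
Proof.
move=> ss; have [cs _] := ss.
have speed0 : 0 <= speed g sigma t by exact: sqrtr_ge0.
have [it|nit] := pselect (in_chart i (sigma t)); last first.
  have nE : \near t, (fun=> 0) t = (manifold_bump \o sigma) t.
    have oE : open (~` E) := closed_openC E_closed.
    have Et : (~` E) (sigma t) by case.
    by apply: filterS (curve_near cs oE Et) => s Es; rewrite /= bump_out.
  have [d D] := near_eq_is_derive nE (is_derive_cst (0 : R) t (1 : R)).
  by split => //; rewrite D normr0 mulr_ge0// ltW.
have nE : \near t, (ball_bump c r \o (atlas i \o sigma)) t =
    (manifold_bump \o sigma) t.
  have := curve_near cs (@chart_dom_open _ _ _ (atlas i)) it.
  by apply: filterS => s is_; rewrite /= bump_in.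
have dg := curve_differentiable ss it.
have [db _] := C1_ball_bump c r (@openT 'rV[R]_n).
have dc := differentiable_comp dg (db _ I).
have D1 : 'D_1 (ball_bump c r \o (atlas i \o sigma)) t =
    'D_(velocity i sigma t) (ball_bump c r) (atlas i (sigma t)).
  rewrite (deriveE _ dc) (deriveE _ (db _ I)) diff_comp//=; last exact: db.
  by rewrite /velocity derive1E'.
have dc1 : derivable (ball_bump c r \o (atlas i \o sigma)) t (1 : R).
  exact: diff_derivable.
have [d ->] := near_eq_is_derive nE (derivableP dc1).
split=> //; rewrite D1.
have [out|inn] := leP r `|atlas i (sigma t) - c|.
  by rewrite derive_ball_bump_out// normr0 mulr_ge0// ltW.
apply: le_trans (derive_ball_bump c _ _ r0) _.
have H := dom (velocity i sigma t) inn.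
have sE := speedE g ss it.
have cK : chart_inv (atlas i) (atlas i (sigma t)) = sigma t.
  exact: chart_mapK.
rewrite cK -sE in H.
apply: (@le_trans _ _ (4 * r ^+ 3 * n%:R * (C * speed g sigma t))).
  by apply: ler_wpM2l H; rewrite !mulr_ge0 ?exprn_ge0 ?(ltW r0).
rewrite /L; move: (4 * r ^+ 3 * n%:R) => K.
by rewrite mulrDl mul1r mulrA lerDl.
Qed.

Lemma manifold_bump_lipschitz p q l : pw_path g p q l ->
  `|manifold_bump q - manifold_bump p| <= L * l.
Proof.
elim=> [|{}l sigma _ IH ss]; first by rewrite subrr normr0 mulr0.
rewrite -(subrKA (manifold_bump (sigma 0))) mulrDr [leRHS]addrC.
apply: le_trans (ler_normD _ _) _; apply: lerD; last exact: IH.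
apply: (@variation_le_integral R (manifold_bump \o sigma) (speed g sigma)).
- exact: speed_continuous.
- by move=> t; have [] := bump_curve t ss.
- by move=> t; have [] := bump_curve t ss.
Qed.

(** At the end point [q] the bump function takes its maximum [r ^+ 4]; it
    cannot fall to zero along a path shorter than [r ^+ 4 / L]. *)
Lemma short_path_in_ball p q l : pw_path g p q l -> l < r ^+ 4 / L ->
  in_chart i q -> atlas i q = c -> in_chart i p /\ `|atlas i p - c| < r.
Proof.
move=> /manifold_bump_lipschitz H lr iq qc.
have : manifold_bump p != 0.
  apply/eqP => p0; move: H; rewrite p0 bump_in// qc subr0 ball_bump_center//.
  rewrite ger0_norm ?exprn_ge0 ?(ltW r0)// leNgt => /negP; apply.
  by rewrite mulrC -ltr_pdivlMr.
rewrite /manifold_bump; case: asboolP => [ip|_]; last by rewrite eqxx.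
by move=> /(ball_bump_neq0 r0).
Qed.

Lemma short_distance_in_ball p q : (riem_dist g p q < (r ^+ 4 / L)%:E)%E ->
  in_chart i q -> atlas i q = c -> in_chart i p /\ `|atlas i p - c| < r.
Proof.
move=> /ereal_inf_lt[_ [l pql <-]]; rewrite lte_fin.
exact: short_path_in_ball.
Qed.

End ManifoldBump.

(** The bound on the distance depends on the centre of the ball only through
    the constant comparing the metric with the norm, so that it is locally
    uniform. *)
Lemma chart_control {R : realType} n (M : smooth_manifold R n)
    (g : riemannian_metric M) (i : chart_idx M) (y0 : 'rV[R]_n) :
  chart_img (atlas i) y0 ->
  exists2 d : R, 0 < d & forall r, 0 < r -> r < d -> exists2 e : R, 0 < e &
    forall p q, in_chart i q -> `|atlas i q - y0| < d ->
      (riem_dist g p q < e%:E)%E ->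
      in_chart i p /\ `|atlas i p - atlas i q| < r.
Proof.
move=> /(norm_le_metric g)[d d0 [C C0 H]]; exists (d / 2).
  by rewrite divr_gt0.
move=> r r0 rd; exists (r ^+ 4 / (4 * r ^+ 3 * n%:R * C + 1)).
  rewrite divr_gt0 ?exprn_gt0// ltr_wpDl// !mulr_ge0 ?exprn_ge0 ?(ltW r0)//.
  exact: ltW.
move=> p q iq qy pq.
have close y : `|y - atlas i q| <= r -> `|y0 - y| < d.
  move=> yq; rewrite -(subrKA (atlas i q)) (splitr d).
  apply: le_lt_trans (ler_normD _ _) _; rewrite distrC [X in _ + X]distrC.
  by apply: ltrD => //; exact: le_lt_trans rd.
apply: (short_distance_in_ball r0 C0 _ _ pq iq erefl) => [y /close/H[]//|y v].
by move=> /ltW/close/H[_]; exact.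
Qed.

(** * C^0 limits of volume-preserving diffeomorphisms *)

Section Distance.
Context {R : realType} {n : nat} {M : smooth_manifold R n}.
Variable g : riemannian_metric M.

Lemma pw_path_ge0 p q l : pw_path g p q l -> 0 <= l.
Proof. by elim=> // {}l sigma _ l0 _; rewrite addr_ge0// curve_length_ge0. Qed.

Lemma riem_dist_refl p : riem_dist g p p = 0%E.
Proof.
apply/eqP; rewrite eq_le; apply/andP; split.
  by apply: ereal_inf_lbound; exists 0 => //; exact: pw_path_nil.
by apply: le_ereal_inf_tmp => _ [l pl <-]; rewrite lee_fin (pw_path_ge0 pl).
Qed.

Lemma C0_closure_sub (A : set (M -> M)) phi : [set: M] !=set0 -> A phi ->
  C0_closure g A phi.
Proof.
move=> [p _] Aphi; exists (fun=> phi) => //.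
suff -> : [set riem_dist g (phi x) (phi x) | x in [set: M]] = [set 0%E].
  by rewrite ereal_sup1; exact: cvg_cst.
apply/seteqP; split => [_ [x _ <-]|_ ->]; first exact: riem_dist_refl.
by exists p => //; exact: riem_dist_refl.
Qed.

Lemma C0_closure_approx (A : set (M -> M)) phi (e : R) : C0_closure g A phi ->
  0 < e -> exists2 phi', A phi' &
    forall x, (riem_dist g (phi' x) (phi x) < e%:E)%E.
Proof.
move=> [phi_ Aphi cv] e0.
have /cv [k _ /(_ k (leqnn k)) /= H] :
    nbhs (0%E : \bar R) [set y | (y < e%:E)%E].
  apply: open_nbhs_nbhs; split; first exact: open_ereal_lt_ereal.
  by rewrite /= lte_fin.
exists (phi_ k) => // x; apply: le_lt_trans H.
by apply: ereal_sup_ubound; exists x.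
Qed.

End Distance.

Section Limit.
Context {R : realType} {n : nat} {M : smooth_manifold R n}.
Variables (Omega : top_form M) (g : riemannian_metric M).

(** The local representative of the inverse of [psi] is continuous. *)
Lemma inverse_rep_control i j (psi : M -> M) p : Diff M psi ->
  in_chart i p -> in_chart j (psi p) -> forall r, 0 < r ->
  exists2 eta : R, 0 < eta & forall x, rep_dom i j psi x ->
    `|local_rep i j psi x - local_rep i j psi (atlas i p)| < eta ->
    `|x - atlas i p| < r.
Proof.
move=> [_ [psi' [[cpsi' _] psiK _]]] ip jp r r0.
set y0 := local_rep i j psi (atlas i p).
pose K y := atlas i (psi' (chart_inv (atlas j) y)).
have KE x : rep_dom i j psi x -> K (local_rep i j psi x) = x.
  by move=> [q [iq jq] <-]; rewrite local_repE// /K chart_mapK// psiK.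
have cK : {for y0, continuous K}.
  have y0E : chart_inv (atlas j) y0 = psi p.
    by rewrite /y0 local_repE// chart_mapK.
  apply: (@continuous_comp _ _ _ (chart_inv (atlas j))
    (fun q => atlas i (psi' q))).
    apply: chart_inv_continuous; exists (psi p) => //.
    by rewrite /y0 local_repE.
  apply: (@continuous_comp _ _ _ psi' (atlas i)); first exact: cpsi'.
  by apply: chart_map_continuous; rewrite y0E psiK.
have /cvgrPdist_lt/(_ _ r0)/nbhs_ballP[eta /= eta0 etaP] := cK.
exists eta => // x Ux xy.
have K0 : K y0 = atlas i p := KE _ (rep_dom_in ip jp).
have Bx : ball y0 eta (local_rep i j psi x).
  by rewrite -ball_normE /ball_ /= distrC.
have H := etaP _ Bx.
by rewrite (KE _ Ux) K0 distrC in H.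
Qed.

Lemma jacobian_limit_chart psi i j p :
  C0_closure g (Diff_vol Omega) psi -> Diff M psi ->
  in_chart i p -> in_chart j (psi p) ->
  density Omega j (psi p) * \det (jac i j psi p) = density Omega i p.
Proof.
move=> psi_cl Dpsi ip jp; have [[cpsi Cpsi] _] := Dpsi.
set x0 := atlas i p; set F := local_rep i j psi; set U := rep_dom i j psi.
have y0E : F x0 = atlas j (psi p) by exact: local_repE.
have oU : open U by exact: rep_dom_open.
have Ux0 : U x0 by exact: rep_dom_in.
have By0 : chart_img (atlas j) (F x0) by rewrite y0E; exists (psi p).
have crho : {for x0, continuous (density Omega i \o chart_inv (atlas i))}.
  by apply: (@density_smooth _ _ _ Omega i 0); exists p.
suff : (density Omega j \o chart_inv (atlas j)) (F x0) * \det ('J F x0) =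
    (density Omega i \o chart_inv (atlas i)) x0.
  by rewrite /= y0E !chart_mapK.
have CF : Ck 2 U F by exact: Cpsi.
apply: (jacobian_limit oU Ux0 CF crho (@chart_img_open _ _ _ (atlas j)) By0).
- exact: density_smooth.
- exact: inverse_rep_control.
have [d d0 dP] := chart_control g By0.
have [r0 r00 r0P] : exists2 r0, 0 < r0 & forall x, `|x - x0| <= r0 ->
    U x /\ `|F x - F x0| < d.
  have [d1 d10 P1] := open_dist oU Ux0.
  have cF : {for x0, continuous F} by exact: Ck_continuous CF x0 Ux0.
  have /cvgrPdist_lt/(_ _ d0)/nbhs_ballP[d2 /= d20 P2] := cF.
  have m0 : 0 < Num.min d1 d2 by rewrite lt_min d10.
  exists (Num.min d1 d2 / 2); first by rewrite divr_gt0.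
  move=> x xr; have : `|x0 - x| < Num.min d1 d2.
    by rewrite distrC; apply: le_lt_trans xr _; lra.
  rewrite lt_min => /andP[x1 x2]; split; first exact: P1.
  by rewrite distrC; apply: P2; rewrite -ball_normE.
exists r0 => // e e0.
have r_gt0 : 0 < Num.min e (d / 2) by rewrite lt_min e0 divr_gt0.
have rd : Num.min e (d / 2) < d by rewrite gt_min; apply/orP; right; lra.
have [e1 e10 e1P] := dP _ r_gt0 rd.
have [phi vphi phiP] := C0_closure_approx psi_cl e10.
have [Dphi _] := vphi; have [[cphi Cphi] _] := Dphi.
exists (local_rep i j phi), (rep_dom i j phi); split.
- exact: rep_dom_open.
- exact: Cphi.
have FE q : in_chart i q -> F (atlas i q) = atlas j (psi q).
  exact: local_repE.
move=> x /r0P[[q [iq jq] <-]]; rewrite FE// => xd.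
have [jphi] := e1P _ _ jq xd (phiP q).
rewrite lt_min => /andP[close _]; rewrite local_repE//; split.
- exact: rep_dom_in.
- exact: close.
- rewrite /= !chart_mapK//.
  exact: ((Diff_volP Omega Dphi).1 vphi).
Qed.

End Limit.

Theorem theorem6 (R : realType) (n : nat) (M : smooth_manifold R n)
    (Omega : top_form M) (g : riemannian_metric M)
    (M_nonempty : [set: M] !=set0)
    (M_compact : compact [set: M]) (M_connected : connected [set: M])
    (M_oriented : oriented_atlas M) (Omega_volume : volume_form Omega) :
  C0_closure g (Diff_vol Omega) `&` Diff M = Diff_vol Omega.
Proof.
apply/seteqP; split => [psi [psi_cl Dpsi]|psi vpsi].
  apply/(Diff_volP Omega Dpsi) => i j p ip jp.
  exact: jacobian_limit_chart psi_cl Dpsi ip jp.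
split; first exact: C0_closure_sub.
by have [] := vpsi.
Qed.
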